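(* Let $q\in(-1,1)$, $q\neq0$. Let $\lambda_q$ be the GNS representation of $C(SU_q(2))$ for the Haar state, acting on $L^2(SU_q(2))\cong\ell^2(\Gamma)$, let $\pi_q$ be the representation of $C(SU_q(2))$ on $\mathcal{H}_\pi=\ell^2(\mathbb{N})\otimes\ell^2(\mathbb{Z})$, and let $U:\ell^2(\Gamma)\to\mathcal{H}_{mult}\otimes\mathcal{H}_\pi$ be the unitary, all as described in the context. Then for every $a\in C(SU_q(2))$, $$U\lambda_q(a)U^*-I\otimes\pi_q(a)\in\mathscr{T}\otimes\mathcal{K}(\mathcal{H}_\pi),$$ where $\mathscr{T}\subseteq\mathcal{L}(\ell^2(\mathbb{N}))=\mathcal{L}(\mathcal{H}_{mult})$ is the Toeplitz algebra and $I$ is the identity operator on $\mathcal{H}_{mult}$.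
   Context: $\mathbb{N}=\{0,1,2,\ldots\}$; $\mathcal{L}$ and $\mathcal{K}$ denote bounded and compact operators. $\mathscr{T}$ is the $C^*$-algebra on $\ell^2(\mathbb{N})$ generated by the unilateral shift, and $\otimes$ of $C^*$-algebras is the spatial tensor product (as operators on the tensor product Hilbert space). $C(SU_q(2))$ is the universal unital $C^*$-algebra generated by $\alpha_q,\beta_q$ (written $\alpha,\beta$ here) with relations $$\alpha^*\alpha+\beta^*\beta=I,\quad \alpha\alpha^*+q^2\beta\beta^*=I,\quad \alpha\beta=q\beta\alpha,\quad \alpha\beta^*=q\beta^*\alpha,\quad \beta^*\beta=\beta\beta^*.$$ Representation $\pi_q$ on $\mathcal{H}_\pi=\ell^2(\mathbb{N})\otimes\ell^2(\mathbb{Z})$: $\pi_q(\alpha_q)=S\sqrt{I-q^{2N}}\otimes I$ and $\pi_q(\beta_q)=q^N\otimes S$. Here on $\ell^2(\mathbb{N})$, $Ne_k=ke_k$, and $S$ is the left shift ($Se_k=e_{k-1}$ for $k\ge1$, $Se_0=0$), while on $\ell^2(\mathbb{Z})$, $S$ denotes $e_k\mapsto e_{k-1}$. Let $\Gamma=\{(n,i,j): n\in\frac12\mathbb{N},\ i,j\in\{-n,-n+1,\ldots,n-1,n\}\}$. The GNS space $L^2(SU_q(2))$ of the Haar state is identified with $\ell^2(\Gamma)$ through the orthonormal basis $e^n_{ij}$ of normalized matrix entries of the irreducible unitary (co)representations of $SU_q(2)$. In this basis the GNS representation (left multiplication) $\lambda_q$ is given by $$\lambda_q(\alpha_q)e^n_{ij}=a_+(n,i,j)e^{n+\frac12}_{i-\frac12,j-\frac12}+a_-(n,i,j)e^{n-\frac12}_{i-\frac12,j-\frac12},$$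 $$\lambda_q(\beta_q)e^n_{ij}=b_+(n,i,j)e^{n+\frac12}_{i+\frac12,j-\frac12}+b_-(n,i,j)e^{n-\frac12}_{i+\frac12,j-\frac12},$$ where, with $g(k)=(1-q^{2k})^{1/2}$, $$a_+(n,i,j)=q^{2n+i+j+1}\frac{g(n-j+1)g(n-i+1)}{g(2n+1)g(2n+2)},\qquad a_-(n,i,j)=\frac{g(n+j)g(n+i)}{g(2n)g(2n+1)},$$ $$b_+(n,i,j)=-q^{n+j}\frac{g(n-j+1)g(n+i+1)}{g(2n+1)g(2n+2)},\qquad b_-(n,i,j)=q^{n+i}\frac{g(n+j)g(n-i)}{g(2n)g(2n+1)}.$$ For $n=0$, $a_-$ and $b_-$ are taken to be $0$. Terms whose basis vector index lies outside $\Gamma$ have coefficient $0$. Let $\mathcal{H}_{mult}=\ell^2(\mathbb{N})$ and let $e(r,s,t)=e_r\otimes e_s\otimes e_t$ ($r,s\in\mathbb{N}$, $t\in\mathbb{Z}$) be the canonical orthonormal basis of $\mathcal{H}_{mult}\otimes\mathcal{H}_\pi$. The unitary $U$ is $$Ue^n_{ij}=(-1)^{\max(i,j)-j}\,e\bigl(n-\max(i,j),\,n+\min(i,j),\,j-i\bigr).$$ *)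

(* Defs.v *)
From HB Require Import structures.
From mathcomp Require Import all_boot all_order all_algebra.
From mathcomp Require Import ring complex finmap.
From mathcomp Require Import all_classical all_reals ereal esum topology.
From mathcomp Require Import normedtype.
From mathcomp Require summability.

Set Implicit Arguments.
Unset Strict Implicit.
Unset Printing Implicit Defensive.
Import Order.TTheory GRing.Theory Num.Theory.
Import numFieldNormedType.Exports.
Import ComplexField.Normc.

Local Open Scope classical_set_scope.
Local Open Scope ring_scope.

Section Ell2.
Context {R : realType} {I : choiceType}.
Local Notation C := R[i].
Implicit Types f g : I -> C.

(* The squared l2-norm, possibly infinite. *)
Definition l2mass f : \bar R := (\esum_(i in [set: I]) (normc (f i) ^+ 2)%:E)%E.

Definition square_summable : {pred (I -> C)} := [pred f | (l2mass f < +oo)%E].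

Lemma l2mass_ge0 f : (0 <= l2mass f)%E.
Proof. by apply: esum_ge0 => i _; rewrite lee_fin sqr_ge0. Qed.

Lemma normc_ge0 (z : C) : 0 <= normc z.
Proof. by case: z => x y; exact: sqrtr_ge0. Qed.

Lemma le_esumZ (c : R) (a : I -> R) : 0 <= c -> (forall i, 0 <= a i) ->
  (\esum_(i in [set: I]) (c * a i)%:E <=
     c%:E * \esum_(i in [set: I]) (a i)%:E)%E.
Proof.
move=> c0 a0; apply: ge_ereal_sup => _ [F [fF _] <-].
under eq_fsbigr do rewrite EFinM.
rewrite -ge0_mule_fsumr; last by move=> i; rewrite lee_fin.
rewrite lee_wpmul2l ?lee_fin//; apply: ereal_sup_ubound.
by exists F.
Qed.

Lemma l2massZ (c : C) f :
  (l2mass (fun i => c * f i)%R <= (normc c ^+ 2)%:E * l2mass f)%E.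
Proof.
apply: (le_trans _ (le_esumZ (sqr_ge0 _) _)); last by move=> i; exact: sqr_ge0.
by apply: le_esum => i _; rewrite lee_fin -exprMn -normcM.
Qed.

(* Young's inequality, from which Minkowski's follows by optimizing in t. *)
Lemma l2massD (t : R) f g : 0 < t ->
  (l2mass (fun i => f i + g i)%R <=
     (1 + t)%:E * l2mass f + (1 + t^-1)%:E * l2mass g)%E.
Proof.
move=> t0; have ti : 0 < t^-1 by rewrite invr_gt0.
have t1 : 0 <= 1 + t by rewrite addr_ge0// ltW.
have ti1 : 0 <= 1 + t^-1 by rewrite addr_ge0// ltW.
have h0 (h : I -> C) i : 0 <= normc (h i) ^+ 2 by exact: sqr_ge0.
apply: le_trans (leeD (le_esumZ t1 (h0 f)) (le_esumZ ti1 (h0 g))).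
rewrite -esumD; try by move=> i _; rewrite lee_fin mulr_ge0.
apply: le_esum => i _; rewrite -EFinD lee_fin.
apply: (@le_trans _ _ ((normc (f i) + normc (g i)) ^+ 2)).
  by rewrite lerXn2r ?nnegrE ?addr_ge0 ?normc_ge0//; exact: le_normcD.
set a := normc (f i); set b := normc (g i).
have -> : (1 + t) * a ^+ 2 + (1 + t^-1) * b ^+ 2 =
    (a + b) ^+ 2 + t * (a - t^-1 * b) ^+ 2 by field; rewrite gt_eqF.
by rewrite lerDl mulr_ge0 ?sqr_ge0// ltW.
Qed.

Fact square_summable_submod : GRing.submod_closed square_summable.
Proof.
split.
  rewrite inE /l2mass/= esum1// => i _.
  by have := normc0 R; rewrite /= => ->; rewrite expr0n.
move=> c f g; rewrite !inE => sf sg.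
apply: le_lt_trans (@l2massD 1 (c *: f) g ltr01) _.
rewrite lte_add_pinfty// lte_mul_pinfty ?lee_fin ?addr_ge0//.
apply: le_lt_trans (l2massZ _ _) _.
by rewrite lte_mul_pinfty ?lee_fin ?sqr_ge0.
Qed.

HB.instance Definition _ :=
  GRing.isSubmodClosed.Build C (I -> C) square_summable square_summable_submod.

Record ell2 := Ell2 { ell2_fun :> I -> C; _ : ell2_fun \in square_summable }.

HB.instance Definition _ := [isSub for ell2_fun].
HB.instance Definition _ := [Choice of ell2 by <:].
HB.instance Definition _ := [SubChoice_isSubLmodule of ell2 by <:].

Definition l2norm (u : ell2) : R := Num.sqrt (fine (l2mass u)).

Lemma l2norm_ge0 u : 0 <= l2norm u. Proof. exact: sqrtr_ge0. Qed.

Lemma l2normE (u : ell2) : l2mass u = (l2norm u ^+ 2)%:E.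
Proof.
have uoo : (l2mass u < +oo)%E by case: u.
rewrite /l2norm sqr_sqrtr ?fine_ge0 ?l2mass_ge0// fineK//.
by rewrite ge0_fin_numE// l2mass_ge0.
Qed.

Lemma le_normc_l2norm (u : ell2) i : normc (u i) <= l2norm u.
Proof.
rewrite -(@ler_pXn2r _ 2)// ?nnegrE ?normc_ge0 ?l2norm_ge0//.
rewrite -lee_fin -l2normE; apply: esum_ge; exists [set i].
  by split=> //; exact: finite_set1.
by rewrite fsbig_set1.
Qed.

Lemma l2norm_eq0 (u : ell2) : l2norm u = 0 -> u = 0.
Proof.
move=> u0; apply/val_inj/funext => i; apply: eq0_normc; apply/eqP.
by rewrite eq_le normc_ge0 andbT -u0 le_normc_l2norm.
Qed.

Lemma l2norm_le (u : ell2) (M : R) : 0 <= M ->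
  (l2mass u <= (M ^+ 2)%:E)%E -> l2norm u <= M.
Proof.
move=> M0; rewrite l2normE lee_fin.
by rewrite ler_pXn2r// nnegrE ?l2norm_ge0.
Qed.

Lemma ler_l2normD (u v : ell2) : l2norm (u + v) <= l2norm u + l2norm v.
Proof.
have [->|u0] := eqVneq u 0; first by rewrite add0r lerDr l2norm_ge0.
have [->|v0] := eqVneq v 0; first by rewrite addr0 lerDl l2norm_ge0.
have gt0 (w : ell2) : w != 0 -> 0 < l2norm w.
  by move=> w0; rewrite lt_def l2norm_ge0 andbT; apply: contra_neq w0 => /l2norm_eq0.
have u_gt0 := gt0 _ u0; have v_gt0 := gt0 _ v0.
apply: l2norm_le; first by rewrite addr_ge0 ?l2norm_ge0.
have t0 : 0 < l2norm v / l2norm u by rewrite divr_gt0.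
apply: le_trans (l2massD u v t0) _.
rewrite !l2normE -!EFinM -EFinD lee_fin le_eqVlt; apply/orP; left; apply/eqP.
by field; rewrite !gt_eqF.
Qed.

Lemma l2normZ_le (c : C) (u : ell2) : l2norm (c *: u) <= normc c * l2norm u.
Proof.
apply: l2norm_le; first by rewrite mulr_ge0 ?normc_ge0 ?l2norm_ge0.
by apply: le_trans (l2massZ c u) _; rewrite l2normE exprMn.
Qed.

Lemma l2normZ (c : C) (u : ell2) : l2norm (c *: u) = normc c * l2norm u.
Proof.
apply/eqP; rewrite eq_le l2normZ_le/=.
have [->|c0] := eqVneq c 0; first by rewrite normc0 mul0r l2norm_ge0.
have nc0 : 0 < normc c.
  by rewrite lt_def normc_ge0 andbT; apply: contra_neq c0 => /eq0_normc.
rewrite -ler_pdivlMl// -normcV -{1}[u](scalerK c0).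
exact: l2normZ_le.
Qed.

Definition ell2_norm (u : ell2) : C := (l2norm u)%:C%C.

Fact ler_ell2_normD u v : ell2_norm (u + v) <= ell2_norm u + ell2_norm v.
Proof. by rewrite -rmorphD/= lecR ler_l2normD. Qed.

Fact ell2_normZ c u : ell2_norm (c *: u) = `|c| * ell2_norm u.
Proof. by rewrite /ell2_norm l2normZ rmorphM. Qed.

Fact ell2_norm0_eq0 u : ell2_norm u = 0 -> u = 0.
Proof. by move=> [] /l2norm_eq0. Qed.

HB.instance Definition _ :=
  Lmodule_isNormed.Build C ell2 ler_ell2_normD ell2_normZ ell2_norm0_eq0.

(* The limit of the finite partial sums (which converge, by Cauchy-Schwarz);
   linear in the first argument. *)
Definition dot (u v : ell2) : C :=
  @summability.sum I C C^o (fun i => u i * (v i)^*%C).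

Definition delta_fun (j : I) : I -> C := fun i => (i == j)%:R.

Fact delta_subproof j : delta_fun j \in square_summable.
Proof.
rewrite inE /l2mass/= (@esumID _ _ [set j])//; last first.
  by move=> i _; rewrite lee_fin sqr_ge0.
rewrite setTI esum_set1 ?lee_fin ?sqr_ge0// esum1 ?adde0 ?ltry// => i [_ /=].
by move=> /eqP; rewrite /delta_fun => /negbTE ->; rewrite normc0 expr0n.
Qed.

Definition ell2_basis j : ell2 := Ell2 (delta_subproof j).

End Ell2.
Arguments ell2 R I : clear implicits.

Local Notation "R '.-op' I" := (ell2 R I -> ell2 R I)
  (at level 2, I at level 1, format "R '.-op'  I").

Section BoundedOperators.
Context {R : realType}.
Local Notation C := R[i].

Definition bounded_op (I J : choiceType) : set (ell2 R I -> ell2 R J) :=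
  [set T | linear T /\ exists M : R, forall x, `|T x| <= M%:C%C * `|x|].

Definition is_adjoint (I J : choiceType)
    (T : ell2 R I -> ell2 R J) (T' : ell2 R J -> ell2 R I) :=
  forall x y, dot (T x) y = dot x (T' y).

Definition unitary (I J : choiceType)
    (U : ell2 R I -> ell2 R J) (Ust : ell2 R J -> ell2 R I) :=
  [/\ bounded_op U, bounded_op Ust, is_adjoint U Ust, cancel U Ust &
      cancel Ust U].

Definition compact_op (I : choiceType) : set (R.-op I) :=
  [set T | bounded_op T /\ compact (closure (T @` [set x | `|x| <= 1]))].

(* Closure inside the bounded operators for the operator norm:
   |T - T'| <= e is spelled out as |T x - T' x| <= e |x| for all x. *)
Definition opnorm_closure (I : choiceType) (X : set (R.-op I)) : set (R.-op I) :=
  [set T | bounded_op T /\ forall e : R, 0 < e ->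
     exists2 T', X T' & forall x, `|T x - T' x| <= e%:C%C * `|x|].

(* Adjoints are given by the relation is_adjoint rather than by a function. *)
Definition cstar_subalg (I : choiceType) (X : set (R.-op I)) :=
  [/\ X `<=` @bounded_op I I,
      X (fun=> 0) /\
        (forall c T T', X T -> X T' -> X (fun x => c *: T x + T' x)),
      (forall T T', X T -> X T' -> X (T \o T')),
      (forall T T', X T -> bounded_op T' -> is_adjoint T T' -> X T') &
      opnorm_closure X `<=` X].

Definition unilateral_shift (T : R.-op nat) :=
  bounded_op T /\ forall k, T (ell2_basis k) = ell2_basis k.+1.

Definition toeplitz : set (R.-op nat) :=
  smallest (@cstar_subalg nat) unilateral_shift.

End BoundedOperators.

Section TensorProduct.
Context {R : realType}.
Local Notation C := R[i].

Lemma l2mass_prod (I J : choiceType) (f : I * J -> C) :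
  l2mass f = (\esum_(i in [set: I]) l2mass (fun j => f (i, j)))%E.
Proof.
rewrite /l2mass esum_esum; last by move=> i j _ _; rewrite lee_fin sqr_ge0.
rewrite (_ : [set: I] `*`` (fun=> [set: J]) = setT); last by apply/seteqP; split.
by apply: eq_esum => -[].
Qed.

Lemma l2mass_reindex (I J : choiceType) (e : I -> J) (f : J -> C) :
  bijective e -> l2mass f = l2mass (f \o e).
Proof.
move=> be; apply: reindex_esum; split => //.
- by move=> x y _ _; apply: bij_inj.
- by case: be => e' _ eK y _; exists (e' y).
Qed.

Section Amplification.
Variables (I J K : choiceType) (s : I * J -> K) (s' : K -> I * J).
Hypotheses (sK : cancel s s') (s'K : cancel s' s).

Fact slice_subproof (F : ell2 R K) i : (fun j => F (s (i, j))) \in square_summable.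
Proof.
have : (l2mass F < +oo)%E by case: F.
rewrite inE/= (@l2mass_reindex _ _ s); last by exists s'.
apply: le_lt_trans; rewrite l2mass_prod.
apply: esum_ge; exists [set i]; first by split=> //; exact: finite_set1.
by rewrite fsbig_set1.
Qed.

Definition slice F i : ell2 R J := Ell2 (slice_subproof F i).

Variables (B : R.-op J) (bB : bounded_op B).

Lemma amplification_mass (F : ell2 R K) (M : R) :
  (forall x, `|B x| <= M%:C%C * `|x|) ->
  (l2mass (fun k => B (slice F (s' k).1) (s' k).2) <= (M ^+ 2)%:E * l2mass F)%E.
Proof.
move=> BM; rewrite (@l2mass_reindex _ _ s); last by exists s'.
rewrite (@l2mass_reindex _ _ s F); last by exists s'.
rewrite [X in (_ <= _ * X)%E]l2mass_prod l2mass_prod.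
have hn i : l2mass (F \o s \o pair i) = (l2norm (slice F i) ^+ 2)%:E.
  exact: (l2normE (slice F i)).
have -> : (\esum_(i in [set: I]) l2mass (fun j => (F \o s) (i, j)))%E =
  (\esum_(i in [set: I]) (l2norm (slice F i) ^+ 2)%:E)%E
  by apply: eq_esum => i _; exact: hn.
apply: le_trans (le_esumZ (sqr_ge0 M) _); last by move=> i; exact: sqr_ge0.
apply: le_esum => i _ /=.
have -> : l2mass (fun j => B (slice F (s' (s (i, j))).1) (s' (s (i, j))).2) =
  l2mass (B (slice F i)).
  by congr l2mass; apply/funext => j; rewrite sK.
rewrite l2normE lee_fin -exprMn lerXn2r ?nnegrE ?l2norm_ge0//.
  have := BM (slice F i); rewrite -rmorphM/= lecR.
  by apply: le_trans; exact: l2norm_ge0.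
by have := BM (slice F i); rewrite -rmorphM/= lecR.
Qed.

Lemma amplification_subproof F :
  (fun k => B (slice F (s' k).1) (s' k).2) \in square_summable.
Proof.
case: bB => _ [M BM]; rewrite inE/=.
apply: le_lt_trans (amplification_mass F BM) _.
by rewrite l2normE -EFinM ltry.
Qed.

Definition amplification F : ell2 R K := Ell2 (amplification_subproof F).

Lemma amplification_bounded : bounded_op amplification.
Proof.
case: (bB) => linB [M BM]; split.
  move=> c F G; apply/val_inj/funext => k /=.
  rewrite (_ : slice _ _ = c *: slice F (s' k).1 + slice G (s' k).1) ?linB//.
  exact/val_inj/funext.
exists `|M|%R => F; rewrite -rmorphM/= lecR.
apply: l2norm_le; first by rewrite mulr_ge0 ?normr_ge0 ?l2norm_ge0.
by rewrite exprMn real_normK ?num_real// EFinM -l2normE; exact: amplification_mass.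
Qed.

End Amplification.

Section Tensor.
Variables (I J : choiceType).

Fact tensor_vec_subproof (u : ell2 R I) (v : ell2 R J) :
  (fun p => u p.1 * v p.2) \in square_summable.
Proof.
rewrite inE/= l2mass_prod.
apply: (@le_lt_trans _ _ ((l2norm v ^+ 2)%:E * l2mass u)%E); last first.
  by rewrite l2normE -EFinM ltry.
apply: le_trans (le_esumZ (sqr_ge0 _) _); last by move=> i; exact: sqr_ge0.
apply: le_esum => i _; have := l2massZ (u i) v.
by rewrite (l2normE v) -EFinM [(normc _ ^+ 2 * _)%R]mulrC.
Qed.

Definition tensor_vec u v : ell2 R (I * J)%type := Ell2 (tensor_vec_subproof u v).

Definition is_tensor (A : R.-op I) (B : R.-op J) (T : R.-op (I * J)%type) :=
  bounded_op T /\ forall u v, T (tensor_vec u v) = tensor_vec (A u) (B v).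

(* The tensor product of Hilbert spaces is l2(I) (x) l2(J) = l2(I * J), and
   A (x) B is the unique bounded operator with u (x) v |-> A u (x) B v; it
   exists for bounded A and B by optensorP (the default 0 is never used then). *)
Definition optensor (A : R.-op I) (B : R.-op J) : R.-op (I * J)%type :=
  xget (fun=> 0) (is_tensor A B).

Lemma bounded_op_comp (K1 K2 K3 : choiceType) (S : ell2 R K2 -> ell2 R K3)
  (T : ell2 R K1 -> ell2 R K2) : bounded_op S -> bounded_op T ->
  bounded_op (S \o T).
Proof.
move=> [linS [M SM]] [linT [N TN]]; split.
  by move=> c x y /=; rewrite linT linS.
exists (`|M| * N) => x /=; apply: le_trans (SM _) _.
apply: (@le_trans _ _ (`|M|%:C%C * `|T x|)).
  by rewrite ler_wpM2r// lecR ler_norm.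
by rewrite rmorphM -mulrA ler_wpM2l// ler0c.
Qed.

Lemma optensorP A B : bounded_op A -> bounded_op B -> is_tensor A B (optensor A B).
Proof.
move=> bA bB; pose sw := fun p : J * I => (p.2, p.1).
pose sw' := fun p : I * J => (p.2, p.1).
have swK : cancel sw sw' by case.
have sw'K : cancel sw' sw by case.
have idK : cancel (@id (I * J)) id by [].
pose TA := amplification swK sw'K bA; pose TB := amplification idK idK bB.
apply: (xgetPex (fun=> 0)); exists (TA \o TB); split.
  by apply: bounded_op_comp; exact: amplification_bounded.
have linZ (K : choiceType) (T : R.-op K) c x : linear T -> T (c *: x) = c *: T x.
  move=> linT; have T0 : T 0 = 0.
    by apply: (addIr (T 0)); have := linT 1 0 0; rewrite !scale1r !add0r.
  by have := linT c x 0; rewrite !addr0 T0 addr0.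
case: (bA) (bB) => [linA _] [linB _] u v; apply/val_inj/funext => -[i j] /=.
have -> : slice swK sw'K (TB (tensor_vec u v)) j = B v j *: u.
  apply/val_inj/funext => i' /=.
  have -> : slice idK idK (tensor_vec u v) i' = u i' *: v.
    by apply/val_inj/funext => j'.
  by rewrite (linZ _ _ _ _ linB); exact: (mulrC (u i') (B v j)).
by rewrite (linZ _ _ _ _ linA); exact: (mulrC (B v j) (A u i)).
Qed.

(* Scalars of the linear combinations are absorbed in the A k. *)
Definition spatial_tensor (X : set (R.-op I)) (Y : set (R.-op J)) :
    set (R.-op (I * J)%type) :=
  opnorm_closure [set T | exists n (A : 'I_n -> R.-op I) (B : 'I_n -> R.-op J),
    [/\ forall k, X (A k), forall k, Y (B k) &
        T = fun x => \sum_(k < n) optensor (A k) (B k) x]].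

End Tensor.
End TensorProduct.

(* Unital C*-algebras. The norm takes values in R: the library's normed modules
   over R[i] have an R[i]-valued norm, and their structure has no join with
   that of algebras. The zero algebra is allowed. *)
HB.mixin Record isCStarAlgebra (R : realType) A & GRing.Algebra R[i] A := {
  star : A -> A;
  starD : {morph star : x y / x + y};
  starZ : forall (c : R[i]) x, star (c *: x) = c^*%C *: star x;
  starM : forall x y : A, star (x * y) = star y * star x;
  starK : involutive star;
  cnorm : A -> R;
  cnormD : forall x y : A, cnorm (x + y) <= cnorm x + cnorm y;
  cnormZ : forall (c : R[i]) x, cnorm (c *: x) = normc c * cnorm x;
  cnorm_eq0 : forall x : A, cnorm x = 0 -> x = 0;
  cnormM : forall x y : A, cnorm (x * y) <= cnorm x * cnorm y;
  cnorm_star : forall x : A, cnorm (star x * x) = cnorm x ^+ 2;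
  cnorm_complete : forall u : nat -> A,
    (forall e, 0 < e -> exists N, forall m n, (N <= m)%N -> (N <= n)%N ->
       cnorm (u m - u n) < e) ->
    exists x, forall e, 0 < e -> exists N, forall n, (N <= n)%N ->
       cnorm (u n - x) < e;
}.

#[short(type="cstarAlgType")]
HB.structure Definition CStarAlgebra (R : realType) :=
  {A of isCStarAlgebra R A & GRing.Algebra R[i] A}.

Section SUq2.
Context {R : realType}.
Implicit Types (A : cstarAlgType R) (q : R).

Definition star_hom A (B : cstarAlgType R) (f : A -> B) :=
  [/\ linear f, forall x y, f (x * y) = f x * f y, f 1 = 1 &
      forall x, f (star x) = star (f x)].

Definition SUq2_relations q A (a b : A) :=
  [/\ star a * a + star b * b = 1,
      a * star a + (q ^+ 2)%:C%C *: (b * star b) = 1,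
      a * b = q%:C%C *: (b * a),
      a * star b = q%:C%C *: (star b * a) &
      star b * b = b * star b].

Definition generated_by A (a b : A) :=
  forall X : set A,
    (forall x, (forall e : R, 0 < e -> exists2 y, X y & cnorm (x - y) < e) ->
       X x) ->
    X a -> X b -> X 1 ->
    (forall c x y, X x -> X y -> X (c *: x + y)) ->
    (forall x y, X x -> X y -> X (x * y)) ->
    (forall x, X x -> X (star x)) -> X = setT.

(* (A, a, b) is the universal unital C*-algebra on the relations: this
   determines it up to a unique isomorphism. *)
Definition is_CSUq2 q A (a b : A) :=
  [/\ SUq2_relations q a b, generated_by a b &
      forall (B : cstarAlgType R) (a' b' : B), SUq2_relations q a' b' ->
        exists! f : A -> B, [/\ star_hom f, f a = a' & f b = b']].

Definition representation A (I : choiceType) (rho : A -> R.-op I) :=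
  [/\ forall x, bounded_op (rho x),
      forall c x y u, rho (c *: x + y) u = c *: rho x u + rho y u,
      forall x y u, rho (x * y) u = rho x (rho y u),
      forall u, rho 1 u = u &
      forall x, is_adjoint (rho x) (rho (star x))].

Definition qg q (k : nat) : R := Num.sqrt (1 - q ^+ (2 * k)).

Definition Hpi_index : choiceType := (nat * int)%type.

(* pi is determined by its values on a and b: a |-> S sqrt(1 - q^(2N)) (x) 1 and
   b |-> q^N (x) S, where S e_0 = 0 on l2(nat). *)
Definition is_pi q A (a b : A) (pi : A -> R.-op Hpi_index) :=
  [/\ representation pi,
      forall k z, pi a (ell2_basis (k, z) : ell2 R Hpi_index) =
        if k is k'.+1 then (qg q k)%:C%C *: ell2_basis (k', z) else 0 &
      forall k z, pi b (ell2_basis (k, z) : ell2 R Hpi_index) =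
        (q ^+ k)%:C%C *: ell2_basis (k, z - 1)].

(* The point (n, i, j) of Gamma is encoded by the triple of natural numbers
   (m, k, l) = (2n, n + i, n + j), so that n - i = m - k and n - j = m - l. *)
Definition Gamma : choiceType :=
  {p : nat * nat * nat | (p.1.2 <= p.1.1)%N && (p.2 <= p.1.1)%N}.

(* The basis vector e^n_ij; (m, k, l) outside Gamma yields 0. *)
Definition eGamma m k l : ell2 R Gamma :=
  if insub (m, k, l) is Some x then ell2_basis x else 0.

(* The guards of a_minus and b_minus say that the target index lies in Gamma;
   they fail in particular when n = 0. The targets of the a_plus and b_plus
   terms are always in Gamma. *)
Definition a_plus q m k l : R :=
  q ^+ (k + l + 1)%N * (qg q (m - l + 1) * qg q (m - k + 1)) /
    (qg q (m + 1) * qg q (m + 2)).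

Definition a_minus q m k l : R :=
  if (0 < k)%N && (0 < l)%N
  then (qg q l * qg q k) / (qg q m * qg q (m + 1)) else 0.

Definition b_plus q m k l : R :=
  - q ^+ l * (qg q (m - l + 1) * qg q (k + 1)) / (qg q (m + 1) * qg q (m + 2)).

Definition b_minus q m k l : R :=
  if (k < m)%N && (0 < l)%N
  then q ^+ k * (qg q l * qg q (m - k)) / (qg q m * qg q (m + 1)) else 0.

(* (n + 1/2, i - 1/2, j - 1/2) is (m + 1, k, l) and (n - 1/2, i - 1/2, j - 1/2)
   is (m - 1, k - 1, l - 1); (n + 1/2, i + 1/2, j - 1/2) is (m + 1, k + 1, l) and
   (n - 1/2, i + 1/2, j - 1/2) is (m - 1, k, l - 1). *)
Definition is_lambda q A (a b : A) (lambda : A -> R.-op Gamma) :=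
  [/\ representation lambda,
      forall m k l, (k <= m)%N -> (l <= m)%N -> lambda a (eGamma m k l) =
        (a_plus q m k l)%:C%C *: eGamma m.+1 k l +
        (a_minus q m k l)%:C%C *: eGamma m.-1 k.-1 l.-1 &
      forall m k l, (k <= m)%N -> (l <= m)%N -> lambda b (eGamma m k l) =
        (b_plus q m k l)%:C%C *: eGamma m.+1 k.+1 l +
        (b_minus q m k l)%:C%C *: eGamma m.-1 k l.-1].

(* max(i, j) - j = max(k, l) - l, n - max(i, j) = m - max(k, l),
   n + min(i, j) = min(k, l) and j - i = l - k. *)
Definition is_U (U : ell2 R Gamma -> ell2 R (nat * Hpi_index)%type)
    (Ust : ell2 R (nat * Hpi_index)%type -> ell2 R Gamma) :=
  unitary U Ust /\
  forall m k l, (k <= m)%N -> (l <= m)%N -> U (eGamma m k l) =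
    (-1) ^+ (maxn k l - l)%N *:
      ell2_basis ((m - maxn k l)%N, (minn k l, l%:Z - k%:Z)).

End SUq2.

(* Main.v *)
From HB Require Import structures.
Require Import Defs.
From mathcomp Require Import all_boot all_order all_algebra.
From mathcomp Require Import ring lra zify complex finmap.
From mathcomp Require Import all_classical all_reals ereal esum topology.
From mathcomp Require Import normedtype sequences.
From mathcomp Require summability.

Set Implicit Arguments.
Unset Strict Implicit.
Unset Printing Implicit Defensive.
Import Order.TTheory GRing.Theory Num.Theory.
Import numFieldNormedType.Exports.
Import ComplexField.Normc.

Local Open Scope classical_set_scope.
Local Open Scope ring_scope.

(* Write D(a) = U lambda(a) U^* - 1 (x) pi(a) and e(r, (s, t)) = U e^n_ij up to
   sign. On this basis D(alpha) and D(beta) are sums of products of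
   (S^d (x) partial isometry), with S^d the shift, the identity or the backward
   shift in r, by diagonal operators whose weights c(r, (s, t)) converge as
   r -> oo and are O(|q|^(s + |t|)) uniformly in r. Such a diagonal operator is a
   norm limit of finite sums over (s, t) of (Toeplitz diagonal) (x) (rank one),
   so D(alpha), D(beta) and their adjoints lie in T (x) K. Finally
   D(ab) = D(a) D(b) + (1 (x) pi(a)) D(b) + D(a) (1 (x) pi(b)), K is an ideal,
   and lambda and pi are contractive, so the elements a with D(a) and D(a^* )
   in T (x) K form a closed star-subalgebra containing the generators. *)

(** * Bounded operators on l2 and the inner product *)

(** As r grows the weights need not vanish: [weight_a1] tends to q^(k + l + 1). So the first factor
    has to be Toeplitz rather than compact, and compactness must come from (s, t) alone. The decay
    in s + |t| has two sources: an explicit power of q, or the cancellation between 1 and a ratio of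
    values of g that are all close to 1. Since s is the smaller of k and l, the sign of t = l - k
    decides which coefficient of beta survives: [b_minus] for t > 0, [b_plus] for t <= 0. The minus
    sign of [b_plus] is undone by the sign in U, which changes under t -> t - 1 exactly when t <= 0.
    Passing from the generators to all of C(SU_q(2)) needs D to be continuous for the C*-norm, while
    a representation is only assumed bounded at each element. Contractivity is therefore derived
    from the C*-identity, with Neumann's series in place of spectral theory. The inner product is a
    limit, and tensor products and weighted pullbacks are given by choice or with a default value.
    Identities between operators are therefore reduced to their values on basis vectors. *)

Section LinearMaps.
Context {K : pzRingType} {V W : lmodType K}.
Variables (T : V -> W) (linT : linear T).

Lemma lin0 : T 0 = 0.
Proof. by apply: (addIr (T 0)); have := linT 1 0 0; rewrite !scale1r !add0r. Qed.

Lemma linD x y : T (x + y) = T x + T y.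
Proof. by have := linT 1 x y; rewrite !scale1r. Qed.

Lemma linZ c x : T (c *: x) = c *: T x.
Proof. by have := linT c x 0; rewrite !addr0 lin0 addr0. Qed.

Lemma linB x y : T (x - y) = T x - T y.
Proof. by rewrite -scaleN1r addrC linT scaleN1r addrC. Qed.

Lemma lin_sum (J : Type) (s : seq J) (F : J -> V) :
  T (\sum_(j <- s) F j) = \sum_(j <- s) T (F j).
Proof. by elim/big_ind2: _ => [|x x' y y' <- <-|//]; [exact: lin0|exact: linD]. Qed.

End LinearMaps.

Section Ell2Facts.
Context {R : realType}.
Local Notation C := R[i].
Implicit Types I J K : choiceType.

Lemma l2norm0 I : l2norm (0 : ell2 R I) = 0.
Proof. by have := l2normZ 0 (0 : ell2 R I); rewrite scale0r normc0 mul0r. Qed.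

Lemma l2normN I (x : ell2 R I) : l2norm (- x) = l2norm x.
Proof. by rewrite -scaleN1r l2normZ normcN normc1 mul1r. Qed.

Lemma ell2_ext I (x y : ell2 R I) : (forall i, x i = y i) -> x = y.
Proof. by move=> xy; apply/val_inj/funext. Qed.

Lemma ell2_normE I (x : ell2 R I) : `|x| = (l2norm x)%:C%C.
Proof. by []. Qed.

(** The norm of [ell2] takes values in [R[i]]; bounds are restated over [R], where the order is
    total. *)
Definition norm_bound I J (T : ell2 R I -> ell2 R J) (M : R) :=
  forall x, l2norm (T x) <= M * l2norm x.

Lemma norm_boundP I J (T : ell2 R I -> ell2 R J) M :
  (forall x, `|T x| <= M%:C%C * `|x|) <-> norm_bound T M.
Proof.
by split=> TM x; have := TM x; rewrite !ell2_normE -rmorphM/= lecR.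
Qed.

Lemma norm_boundW I J (T : ell2 R I -> ell2 R J) (M N : R) :
  M <= N -> norm_bound T M -> norm_bound T N.
Proof.
by move=> MN TM x; apply: le_trans (TM x) _; rewrite ler_wpM2r ?l2norm_ge0.
Qed.

Lemma bounded_opP I J (T : ell2 R I -> ell2 R J) :
  bounded_op T <-> linear T /\ exists2 M, 0 <= M & norm_bound T M.
Proof.
split=> -[linT]; last by case=> M _ TM; split=> //; exists M; apply/norm_boundP.
case=> M /norm_boundP TM; split=> //; exists `|M|; first exact: normr_ge0.
exact: norm_boundW (ler_norm M) TM.
Qed.

Lemma bounded_op_linear I J (T : ell2 R I -> ell2 R J) : bounded_op T -> linear T.
Proof. by case. Qed.

Lemma bounded_op_lincomb I J (c : C) (S T : ell2 R I -> ell2 R J) :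
  bounded_op S -> bounded_op T -> bounded_op (fun x => c *: S x + T x).
Proof.
move=> /bounded_opP[linS [M M0 SM]] /bounded_opP[linT [N N0 TN]].
apply/bounded_opP; split.
  move=> d x y; rewrite linS linT !scalerDr !scalerA [c * d]mulrC addrACA.
  by [].
exists (normc c * M + N); first by rewrite addr_ge0// mulr_ge0// normc_ge0.
move=> x; apply: le_trans (ler_l2normD _ _) _.
by rewrite l2normZ mulrDl lerD// -mulrA ler_wpM2l// normc_ge0.
Qed.

Lemma bounded_op0 I J : bounded_op ((fun=> 0) : ell2 R I -> ell2 R J).
Proof.
apply/bounded_opP; split; first by move=> c x y; rewrite scaler0 addr0.
by exists 0 => // x; rewrite l2norm0 mul0r.
Qed.

Lemma bounded_opD I J (S T : ell2 R I -> ell2 R J) :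
  bounded_op S -> bounded_op T -> bounded_op (fun x => S x + T x).
Proof.
move=> bS bT; have := bounded_op_lincomb 1 bS bT.
by congr bounded_op; apply/funext => x; rewrite scale1r.
Qed.

Lemma bounded_opB I J (S T : ell2 R I -> ell2 R J) :
  bounded_op S -> bounded_op T -> bounded_op (fun x => S x - T x).
Proof.
move=> bS bT; have := bounded_op_lincomb (-1) bT bS.
by congr bounded_op; apply/funext => x; rewrite scaleN1r addrC.
Qed.

Lemma bounded_opZ I J (c : C) (T : ell2 R I -> ell2 R J) :
  bounded_op T -> bounded_op (fun x => c *: T x).
Proof.
move=> bT; have := bounded_op_lincomb c bT (@bounded_op0 I J).
by congr bounded_op; apply/funext => x; rewrite addr0.
Qed.

Lemma bounded_op_id I : bounded_op (@id (ell2 R I)).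
Proof.
by apply/bounded_opP; split=> //; exists 1 => // x; rewrite mul1r.
Qed.

Lemma ell2_coordD I (x y : ell2 R I) i : (x + y) i = x i + y i.
Proof. by []. Qed.

Lemma ell2_coordZ I c (x : ell2 R I) i : (c *: x) i = c * x i.
Proof. by []. Qed.

Lemma ell2_coordB I (x y : ell2 R I) i : (x - y) i = x i - y i.
Proof. by []. Qed.

Lemma ell2_coord_sum I (J : Type) (s : seq J) (F : J -> ell2 R I) i :
  (\sum_(j <- s) F j) i = \sum_(j <- s) F j i.
Proof. by elim/big_rec2: _ => //= j x y _ <-. Qed.

Lemma ell2_basisE I (j i : I) : (ell2_basis j : ell2 R I) i = (i == j)%:R.
Proof. by []. Qed.

Lemma l2mass_fin I (x : ell2 R I) : l2mass x \is a fin_num.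
Proof. by rewrite l2normE. Qed.

Lemma sum_basisE I (s : seq I) (x : ell2 R I) i : uniq s ->
  (\sum_(j <- s) x j *: ell2_basis j) i = if i \in s then x i else 0.
Proof.
move=> us; rewrite ell2_coord_sum; case: ifPn => [si|nsi].
  rewrite (bigD1_seq i)// ell2_coordZ ell2_basisE eqxx mulr1.
  rewrite big1; first exact: addr0.
  by move=> j ji; rewrite ell2_coordZ ell2_basisE eq_sym (negbTE ji) mulr0.
rewrite big1_seq// => j /andP[_ sj]; rewrite ell2_coordZ ell2_basisE.
by case: eqVneq => [ij|]; rewrite ?mulr0//; move: nsi; rewrite ij sj.
Qed.

(** A finite set whose partial sum is within e^2 of the total mass leaves a remainder of norm at
    most e. *)
Lemma ell2_dense I (x : ell2 R I) (e : R) : 0 < e ->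
  exists s : seq I, l2norm (x - \sum_(j <- s) x j *: ell2_basis j) <= e.
Proof.
move=> e0.
have h0 (z : C) : (0 <= (normc z ^+ 2)%:E)%E by rewrite lee_fin sqr_ge0.
have [_ [F [finF _] <-] lt] := @ub_ereal_sup_adherent R _ (e ^+ 2) (exprn_gt0 2 e0)
  (l2mass_fin x).
exists (fset_set F); apply: l2norm_le; first exact: ltW.
rewrite /l2mass (@esumID _ _ F)//.
rewrite setTI esum1 ?add0e; last first.
  move=> i Fi; rewrite ell2_coordB sum_basisE ?fset_uniq// in_fset_set// mem_set//.
  by rewrite subrr normc0 expr0n.
rewrite (eq_esum (b := fun i => (normc (x i) ^+ 2)%:E)); last first.
  move=> i [_ Fi]; rewrite ell2_coordB sum_basisE ?fset_uniq// in_fset_set//.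
  by rewrite memNset// subr0.
move: lt; rewrite -/(esum _ _) [X in (X - _ < _)%E -> _](@esumID _ _ F)//.
have finS : (\sum_(i \in F) (normc (x i) ^+ 2)%:E)%E \is a fin_num.
  by rewrite fsumEFin.
rewrite setTI esum_fset// lteBlDr// lteD2lE// => /ltW.
exact.
Qed.
(** Density of finite combinations turns checks on bounded maps into checks on basis vectors:
    equality of operators through coordinates, adjointness through each argument of [dot]. *)
Lemma bounded_functional_eq0 I (f : ell2 R I -> C) (M : R) :
  (forall c x y, f (c *: x + y) = c * f x + f y) -> 0 <= M ->
  (forall x, normc (f x) <= M * l2norm x) ->
  (forall i, f (ell2_basis i) = 0) -> forall x, f x = 0.
Proof.
move=> lf M0 fM f0 x; apply/eq0_normc/eqP.
have {}lf : linear (f : ell2 R I -> C^o) by [].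
rewrite eq_le normc_ge0 andbT; apply/ler_addgt0Pl => e e0; rewrite addr0.
(* The bound M may be 0, so M + 1 serves as divisor; the same device recurs below. *)
have M1 : 0 < M + 1 by rewrite ltr_wpDl.
have [s ls] := @ell2_dense _ x (e / (M + 1)) (divr_gt0 e0 M1).
set y := \sum_(j <- s) _ in ls.
have -> : f x = f (x - y).
  rewrite (linB lf) /y (lin_sum lf) big1 ?subr0// => j _.
  by rewrite (linZ lf) f0 scaler0.
apply: le_trans (fM _) _; apply: (@le_trans _ _ ((M + 1) * (e / (M + 1)))).
  by apply: ler_pM => //; rewrite ?l2norm_ge0// lerDl.
by rewrite mulrC divfK// gt_eqF.
Qed.

Lemma bounded_op_eq I J (S T : ell2 R I -> ell2 R J) :
  bounded_op S -> bounded_op T ->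
  (forall i, S (ell2_basis i) = T (ell2_basis i)) -> S = T.
Proof.
move=> bS bT eqST; apply/funext => x; apply: ell2_ext => k.
have /bounded_opP[lD [M M0 DM]] := bounded_opB bS bT.
apply/eqP; rewrite -subr_eq0; apply/eqP.
apply: (@bounded_functional_eq0 _ (fun x => S x k - T x k) M) => //.
- by move=> c y z; have := congr1 (fun u : ell2 R J => u k) (lD c y z).
- by move=> y; apply: le_trans (DM y); exact: (le_normc_l2norm (S y - T y)).
- by move=> i; rewrite eqST subrr.
Qed.

(** * Unconditional sums and the inner product *)

Lemma complex_gt0 (e : C) : 0 < e -> e = (complex.Re e)%:C%C /\ 0 < complex.Re e.
Proof. by case: e => a b; rewrite ltcE /= => /andP[/eqP -> ?]. Qed.

Lemma normr_normc (z : C) : `|z| = (normc z)%:C%C.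
Proof. by rewrite normc_def; case: z. Qed.

(** Convergence along the directed set of finite subsets. [summability.sum] is a limit that is
    meaningful only once convergence is known, and [sums_to] carries that information. *)
Definition sums_to I (f : I -> C) (l : C) := forall e : R, 0 < e ->
  exists F : {fset I}, forall B : {fset I}, (F `<=` B)%fset ->
    normc (l - \sum_(i <- B) f i) <= e.

#[local] Existing Instance summability.totally_filter.

Lemma sums_toE I (f : I -> C) l : sums_to f l -> @summability.sum I C C^o f = l.
Proof.
move=> fl; apply: (@cvg_lim C^o (@norm_hausdorff C C^o)).
apply/(@cvgrPdist_le C C^o) => e /complex_gt0[-> /fl[F FB]].
exists F => // B /= /FB; rewrite normr_normc lecR.
by rewrite /summability.partial_sum -(big_seq_fsetE _ _ xpredT f).
Qed.

Lemma sums_toD I (f g : I -> C) k l : sums_to f k -> sums_to g l ->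
  sums_to (fun i => f i + g i) (k + l).
Proof.
move=> fk gl e e0; have e20 : 0 < e / 2 by rewrite divr_gt0.
have [F Fk] := fk _ e20; have [G Gl] := gl _ e20.
exists (F `|` G)%fset => B; rewrite fsubUset => /andP[/Fk kB /Gl lB].
rewrite big_split /= opprD addrACA (splitr e).
by apply: le_trans (le_normcD _ _) _; exact: lerD.
Qed.

Lemma sums_toZ I (c : C) (f : I -> C) l : sums_to f l ->
  sums_to (fun i => c * f i) (c * l).
Proof.
move=> fl e e0; have c0 : 0 < normc c + 1 by rewrite ltr_wpDl// normc_ge0.
have [F Fl] := fl _ (divr_gt0 e0 c0).
exists F => B /Fl lB; rewrite -mulr_sumr -mulrBr normcM.
apply: (@le_trans _ _ ((normc c + 1) * (e / (normc c + 1)))).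
  by apply: ler_pM; rewrite ?normc_ge0// lerDl.
by rewrite mulrC divfK// gt_eqF.
Qed.

Lemma sums_to_mass I (x : ell2 R I) :
  sums_to (fun i => x i * (x i)^*%C) ((l2norm x ^+ 2)%:C%C).
Proof.
move=> r e0.
have [_ [F [finF _] <-] lt] := @ub_ereal_sup_adherent R _ r e0 (l2mass_fin x).
exists (fset_set F) => B FB.
have -> : \sum_(i <- B) x i * (x i)^*%C = (\sum_(i <- B) normc (x i) ^+ 2)%:C%C.
  rewrite (big_morph (real_complex R) (raddfD _) (raddf0 _)).
  by apply: eq_bigr => i _; rewrite -sqr_normc normr_normc rmorphXn.
rewrite -rmorphB /= expr0n addr0 sqrtr_sqr.
have leB : \sum_(i <- B) normc (x i) ^+ 2 <= l2norm x ^+ 2.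
  rewrite -lee_fin -l2normE; apply: esum_ge; exists [set` B].
    by split=> //; exact: finite_fset.
  by rewrite fsumEFin ?finite_fset// fsbig_finite ?finite_fset//= set_fsetK lexx.
have ltF : l2norm x ^+ 2 - r < \sum_(i <- fset_set F) normc (x i) ^+ 2.
  rewrite -lte_fin EFinB -l2normE; move: lt.
  by rewrite fsumEFin// fsbig_finite.
have leFB : \sum_(i <- fset_set F) normc (x i) ^+ 2 <= \sum_(i <- B) normc (x i) ^+ 2.
  (* Extended by 0 outside the smaller set, the summand keeps its sum and lies below the mass on
     B. *)
  pose h i := if i \in fset_set F then normc (x i) ^+ 2 else 0.
  have -> : \sum_(i <- fset_set F) normc (x i) ^+ 2 = \sum_(i <- fset_set F) h i.
    by apply: eq_big_seq => i iF; rewrite /h iF.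
  rewrite (big_fset_incl _ FB) => [|i _ /negbTE iF]; last by rewrite /h iF.
  by apply: ler_sum => i _; rewrite /h; case: ifP => // _; exact: sqr_ge0.
by rewrite ger0_norm ?subr_ge0//; lra.
Qed.

(* Polarization makes the series of the inner product a combination of four
   series with nonnegative terms. *)
Lemma sums_to_dot I (u v : ell2 R I) :
  sums_to (fun i => u i * (v i)^*%C) (dot u v).
Proof.
suff [l ul] : exists l, sums_to (fun i => u i * (v i)^*%C) l.
  by rewrite /dot (sums_toE ul).
(* For a form linear in its first argument, 4 <u, v> is the sum of k |u + k v|^2 over k = 1, -1, i,
   -i. *)
pose P (k : C) := sums_toZ (k / 4) (sums_to_mass (u + k *: v)).
have H := sums_toD (sums_toD (P 1) (P (-1))) (sums_toD (P 'i%C) (P (- 'i%C))).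
eexists; move: H; congr sums_to; apply/funext => i.
rewrite !ell2_coordD !ell2_coordZ.
case: (u i) => a b; case: (v i) => c d.
by apply/eqP; rewrite eq_complex /=; apply/andP; split; apply/eqP; field.
Qed.

Lemma dotDl I (u v w : ell2 R I) : dot (u + v) w = dot u w + dot v w.
Proof.
rewrite -(sums_toE (sums_toD (sums_to_dot u w) (sums_to_dot v w))) /dot.
by congr (@summability.sum I C C^o _); apply/funext => i; rewrite -mulrDl.
Qed.

Lemma dotZl I c (u w : ell2 R I) : dot (c *: u) w = c * dot u w.
Proof.
rewrite -(sums_toE (sums_toZ c (sums_to_dot u w))) /dot.
by congr (@summability.sum I C C^o _); apply/funext => i; rewrite mulrA.
Qed.

Lemma normcJ (z : C) : normc (z^*)%C = normc z.
Proof. by case: z => a b /=; rewrite sqrrN. Qed.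

Lemma dotC I (u v : ell2 R I) : dot v u = ((dot u v)^*)%C.
Proof.
apply: sums_toE => e /(sums_to_dot u v)[F FB]; exists F => B /FB.
rewrite -normcJ rmorphB rmorph_sum /=; congr (normc (_ - _) <= _).
by apply: eq_bigr => i _; rewrite rmorphM /= conjcK mulrC.
Qed.

Lemma dotDr I (u v w : ell2 R I) : dot w (u + v) = dot w u + dot w v.
Proof. by rewrite dotC dotDl rmorphD /= -!dotC. Qed.

Lemma dotZr I c (u w : ell2 R I) : dot w (c *: u) = (c^*)%C * dot w u.
Proof. by rewrite dotC dotZl rmorphM /= -dotC. Qed.

Lemma dotNl I (u w : ell2 R I) : dot (- u) w = - dot u w.
Proof. by rewrite -scaleN1r dotZl mulN1r. Qed.

Lemma dotNr I (u w : ell2 R I) : dot w (- u) = - dot w u.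
Proof. by rewrite dotC dotNl rmorphN /= -dotC. Qed.

Lemma dotBl I (u v w : ell2 R I) : dot (u - v) w = dot u w - dot v w.
Proof. by rewrite dotDl dotNl. Qed.

Lemma dotBr I (u v w : ell2 R I) : dot w (u - v) = dot w u - dot w v.
Proof. by rewrite dotDr dotNr. Qed.

Lemma dotxx I (u : ell2 R I) : dot u u = (l2norm u ^+ 2)%:C%C.
Proof. exact: (sums_toE (@sums_to_mass I u)). Qed.

Lemma dot_basisr I (u : ell2 R I) k : dot u (ell2_basis k) = u k.
Proof.
apply: sums_toE => e e0; exists [fset k]%fset => B /fsubsetP/(_ k).
rewrite in_fset1 eqxx => /(_ isT) kB.
rewrite (bigD1_seq k)// big1 => [|i ik]; rewrite ell2_basisE /=.
  by rewrite eqxx conjc1 mulr1 addr0 subrr normc0 ltW.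
by rewrite (negbTE ik) conjc0 mulr0.
Qed.

Lemma dot_basisl I (u : ell2 R I) k : dot (ell2_basis k) u = ((u k)^*)%C.
Proof. by rewrite dotC dot_basisr. Qed.

Lemma l2norm_sqB I (u v : ell2 R I) (k : R) : l2norm (u - k%:C%C *: v) ^+ 2 =
  l2norm u ^+ 2 - 2 * k * complex.Re (dot u v) + k ^+ 2 * l2norm v ^+ 2.
Proof.
apply: complexI; rewrite -dotxx dotBl !dotBr !dotZl !dotZr !dotxx (dotC u v).
case: (dot u v) => a b; rewrite conjc_real.
by apply/eqP; rewrite eq_complex /=; apply/andP; split; apply/eqP; ring.
Qed.

(** With k = |u| / |v|, the square |u - k v|^2 equals 2k (|u| |v| - Re <u, v>). *)
Lemma Re_dot_le I (u v : ell2 R I) : complex.Re (dot u v) <= l2norm u * l2norm v.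
Proof.
have [v0|v0] := eqVneq (l2norm v) 0.
  rewrite (l2norm_eq0 v0) dotC -(scale0r v) dotZl mul0r conjc0 /=.
  by rewrite mulr_ge0 ?l2norm_ge0.
have nv : 0 < l2norm v by rewrite lt_def v0 l2norm_ge0.
have [u0|u0] := eqVneq (l2norm u) 0.
  by rewrite (l2norm_eq0 u0) -(scale0r v) dotZl mul0r /= mulr_ge0 ?l2norm_ge0.
have nu : 0 < l2norm u by rewrite lt_def u0 l2norm_ge0.
have := sqr_ge0 (l2norm (u - (l2norm u / l2norm v)%:C%C *: v)).
rewrite l2norm_sqB; set d := complex.Re _.
have -> : l2norm u ^+ 2 - 2 * (l2norm u / l2norm v) * d +
    (l2norm u / l2norm v) ^+ 2 * l2norm v ^+ 2 =
  2 * (l2norm u / l2norm v) * (l2norm u * l2norm v - d) by field.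
by rewrite pmulr_rge0 ?subr_ge0// mulr_gt0// divr_gt0.
Qed.

Lemma normc_dot_le I (u v : ell2 R I) : normc (dot u v) <= l2norm u * l2norm v.
Proof.
have [d0|d0] := eqVneq (normc (dot u v)) 0.
  by rewrite d0 mulr_ge0 ?l2norm_ge0.
have nd : 0 < normc (dot u v) by rewrite lt_def d0 normc_ge0.
(* Multiplying u by the conjugate of <u, v> turns the inner product into the real number |<u, v>|^2,
   which reduces the claim to real parts. *)
rewrite -(ler_pM2l nd) mulrA -normcJ -l2normZ.
apply: le_trans (Re_dot_le _ _); rewrite dotZl normcJ.
case: (dot u v) => a b /=; rewrite -expr2 sqr_sqrtr ?addr_ge0 ?sqr_ge0//.
by rewrite !expr2 mulNr opprK.
Qed.

Lemma is_adjoint_basis I J (T : ell2 R I -> ell2 R J) (T' : ell2 R J -> ell2 R I) :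
  bounded_op T -> bounded_op T' ->
  (forall j k, T (ell2_basis j) k = ((T' (ell2_basis k) j)^*)%C) ->
  is_adjoint T T'.
Proof.
move=> /bounded_opP[lT [M M0 TM]] /bounded_opP[lT' [M' M'0 T'M]] TT'.
have H k x : T x k = dot x (T' (ell2_basis k)).
  apply/eqP; rewrite -subr_eq0; apply/eqP.
  apply: (@bounded_functional_eq0 _ (fun x => T x k - dot x (T' (ell2_basis k)))
    (M + M' * l2norm (ell2_basis k : ell2 R J))).
  - move=> c y z; rewrite lT dotDl dotZl ell2_coordD ell2_coordZ mulrBr.
    by rewrite opprD addrACA.
  - by rewrite addr_ge0// mulr_ge0// l2norm_ge0.
  - move=> y; apply: le_trans (le_normcD _ _) _; rewrite normcN mulrDl lerD//.
      by apply: le_trans (TM y); exact: le_normc_l2norm.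
    apply: le_trans (normc_dot_le _ _) _; rewrite mulrC.
    by rewrite ler_wpM2r ?l2norm_ge0.
  - by move=> j; rewrite TT' dot_basisl subrr.
move=> x y; apply/eqP; rewrite -subr_eq0; apply/eqP.
(* Both inner products are conjugate-linear in y; conjugation makes their difference a linear
   functional of y. *)
rewrite (dotC y (T x)) (dotC (T' y) x) -rmorphB -[RHS]conjc0; congr (_^*)%C.
apply: (@bounded_functional_eq0 _ (fun y => dot y (T x) - dot (T' y) x)
  ((M + M') * l2norm x)).
- move=> c z t; rewrite lT' !dotDl !dotZl mulrBr.
  by rewrite opprD addrACA.
- by rewrite mulr_ge0 ?addr_ge0 ?l2norm_ge0.
- move=> z; apply: le_trans (le_normcD _ _) _; rewrite normcN !mulrDl lerD//.
    apply: le_trans (normc_dot_le _ _) _; rewrite mulrC.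
    by rewrite ler_wpM2r ?l2norm_ge0.
  apply: le_trans (normc_dot_le _ _) _; rewrite mulrAC.
  by rewrite ler_wpM2r ?l2norm_ge0.
- by move=> k; rewrite dot_basisl H -dotC subrr.
Qed.

Lemma is_adjoint_uniq I J (T : ell2 R I -> ell2 R J) (T' T'' : ell2 R J -> ell2 R I) :
  is_adjoint T T' -> is_adjoint T T'' -> T' = T''.
Proof.
move=> TT' TT''; apply/funext => y; apply: ell2_ext => i.
by rewrite -[LHS]conjcK -[RHS]conjcK -!dot_basisl -TT' -TT''.
Qed.

Lemma is_adjoint_sym I J (T : ell2 R I -> ell2 R J) (T' : ell2 R J -> ell2 R I) :
  is_adjoint T T' -> is_adjoint T' T.
Proof. by move=> TT' x y; rewrite dotC -TT' -dotC. Qed.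

Lemma is_adjoint_comp I J K (S : ell2 R J -> ell2 R K) S'
  (T : ell2 R I -> ell2 R J) T' : is_adjoint S S' -> is_adjoint T T' ->
  is_adjoint (S \o T) (T' \o S').
Proof. by move=> SS' TT' x y /=; rewrite SS' TT'. Qed.

Lemma is_adjointD I J (S T : ell2 R I -> ell2 R J) S' T' :
  is_adjoint S S' -> is_adjoint T T' ->
  is_adjoint (fun x => S x + T x) (fun x => S' x + T' x).
Proof. by move=> SS' TT' x y; rewrite dotDl dotDr SS' TT'. Qed.

Lemma is_adjointB I J (S T : ell2 R I -> ell2 R J) S' T' :
  is_adjoint S S' -> is_adjoint T T' ->
  is_adjoint (fun x => S x - T x) (fun x => S' x - T' x).
Proof. by move=> SS' TT' x y; rewrite dotBl dotBr SS' TT'. Qed.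

End Ell2Facts.

(** * Representations of a C*-algebra are contractive *)

Lemma expr_eventually_lt {R : realType} (t e : R) : `|t| < 1 -> 0 < e ->
  exists N, forall n, (N <= n)%N -> `|t| ^+ n < e.
Proof.
move=> t1 e0; have /cvgrPdist_lt/(_ _ e0)[N _ NP] := cvg_expr t1.
by exists N => n /NP; rewrite sub0r normrN normrX.
Qed.

Section Neumann.
Context {R : realType} {A : cstarAlgType R}.
Implicit Types x y h : A.

Lemma cnorm0 : cnorm (0 : A) = 0.
Proof. by have := cnormZ 0 (0 : A); rewrite scale0r normc0 mul0r. Qed.

Lemma cnormN x : cnorm (- x) = cnorm x.
Proof. by rewrite -scaleN1r cnormZ normcN normc1 mul1r. Qed.

Lemma cnorm_ge0 x : 0 <= cnorm x.
Proof.
have := cnormD x (- x); rewrite subrr cnorm0 cnormN; lra.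
Qed.

(** The factor [cnorm 1] is kept because it vanishes in the zero algebra. *)
Lemma cnormX h n : cnorm (h ^+ n) <= cnorm (1 : A) * cnorm h ^+ n.
Proof.
elim: n => [|n IHn]; first by rewrite !expr0 mulr1.
rewrite !exprSr mulrA; apply: le_trans (cnormM _ _) _.
by rewrite ler_wpM2r// cnorm_ge0.
Qed.

Lemma neumann_left_inverse h : cnorm h < 1 -> exists y, y * (1 - h) = 1.
Proof.
move=> h1; set t := cnorm h in h1; set K := cnorm (1 : A).
have t0 : 0 <= t by exact: cnorm_ge0.
have K0 : 0 <= K by exact: cnorm_ge0.
have t1 : 0 < 1 - t by rewrite subr_gt0.
pose u n := \sum_(i < n) h ^+ i.
have uS n : u n.+1 = u n + h ^+ n by rewrite /u big_ord_recr.
have un n : u n * (1 - h) = 1 - h ^+ n.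
  elim: n => [|n IHn]; first by rewrite /u big_ord0 mul0r subrr.
  by rewrite uS mulrDl IHn mulrBr mulr1 -exprSr addrA subrK.
have tail n k : cnorm (u (n + k)%N - u n) <= K / (1 - t) * t ^+ n.
  (* The exact value of the finite geometric sum is what makes the induction on k go through. *)
  suff : cnorm (u (n + k)%N - u n) <= K / (1 - t) * (t ^+ n - t ^+ (n + k)).
    move=> /le_trans; apply; rewrite ler_wpM2l ?divr_ge0 ?(ltW t1)//.
    by rewrite lerBlDr lerDl exprn_ge0.
  elim: k => [|k IHk]; first by rewrite addn0 !subrr cnorm0 mulr0.
  rewrite addnS uS addrAC; apply: le_trans (cnormD _ _) _.
  apply: le_trans (lerD IHk (cnormX _ _)) _; rewrite -/K -/t exprS.
  rewrite le_eqVlt; apply/orP; left; apply/eqP; field.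
  by rewrite gt_eqF.
(* One constant dominates both the tail bound and the bound K t^n on h^n; the summand 1 makes it
   positive. *)
have small e : 0 < e -> exists N, forall n, (N <= n)%N ->
    (K / (1 - t) + K + 1) * t ^+ n < e.
  move=> e0; have c0 : 0 < K / (1 - t) + K + 1.
    by rewrite ltr_wpDl// addr_ge0// divr_ge0// ltW.
  have t1' : `|t| < 1 by rewrite ger0_norm.
  have [N NP] := expr_eventually_lt t1' (divr_gt0 e0 c0).
  exists N => n /NP; rewrite ger0_norm//.
  by rewrite ltr_pdivlMr// mulrC.
have tail' n k : cnorm (u (n + k)%N - u n) <= (K / (1 - t) + K + 1) * t ^+ n.
  apply: le_trans (tail n k) _; rewrite ler_wpM2r ?exprn_ge0//.
  by rewrite -addrA lerDl addr_ge0.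
have [y yP] : exists y, forall e, 0 < e -> exists N, forall n, (N <= n)%N ->
    cnorm (u n - y) < e.
  apply: cnorm_complete => e e0; have [N NP] := small _ e0.
  exists N => m n Nm Nn; have [mn|/ltnW nm] := leqP m n.
    rewrite -(subnKC mn) -cnormN opprB.
    by apply: le_lt_trans (tail' _ _) _; exact: NP.
  by rewrite -(subnKC nm); apply: le_lt_trans (tail' _ _) _; exact: NP.
exists y; apply/eqP; rewrite -subr_eq0; apply/eqP/cnorm_eq0/eqP.
rewrite eq_le cnorm_ge0 andbT; apply/ler_addgt0Pl => e e0; rewrite addr0.
have c1 : 0 < cnorm (1 - h) + 1 by rewrite ltr_wpDl// cnorm_ge0.
have [N1 N1P] := yP _ (divr_gt0 (divr_gt0 e0 (ltr0n _ 2)) c1).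
have [N2 N2P] := small _ (divr_gt0 e0 (ltr0n _ 2)).
pose n := maxn N1 N2.
have -> : y * (1 - h) - 1 = - ((u n - y) * (1 - h)) - h ^+ n.
  by rewrite mulrBl un opprB -addrA -opprD subrK.
apply: le_trans (cnormD _ _) _; rewrite !cnormN (splitr e) lerD//.
  apply: le_trans (cnormM _ _) _.
  have := N1P n (leq_maxl _ _); rewrite ltr_pdivlMr// => /ltW; apply: le_trans.
  by rewrite ler_wpM2l ?cnorm_ge0// lerDl.
apply: le_trans (cnormX _ _) _; apply: le_trans (ltW (N2P n (leq_maxr _ _))).
rewrite ler_wpM2r ?exprn_ge0// -/K addrAC lerDr.
by rewrite addr_ge0// divr_ge0// ltW.
Qed.

End Neumann.

Section Contractivity.
Context {R : realType} {A : cstarAlgType R} {I : choiceType}.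
Variables (rho : A -> ell2 R I -> ell2 R I) (rhoP : representation rho).

(* Let K be the least constant with |rho x u|^2 <= K |u|^2. On vectors that
   nearly attain it, K - rho (x^* x) nearly vanishes, so it cannot be
   left-invertible; by Neumann's series K <= |x^* x|. *)
Lemma representation_contractive (x : A) : norm_bound (rho x) (cnorm x).
Proof.
case: (rhoP) => bnd lin mul one adj.
have [_ [M M0 xM]] := (bounded_opP (rho x)).1 (bnd x).
pose E := [set K : R | 0 <= K /\
  forall u, l2norm (rho x u) ^+ 2 <= K * l2norm u ^+ 2].
have EM : E (M ^+ 2).
  split=> [|u]; first exact: sqr_ge0.
  by rewrite -exprMn lerXn2r ?nnegrE ?mulr_ge0 ?l2norm_ge0.
have infE : has_inf E by split; [exists (M ^+ 2)|exists 0 => K []].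
pose K := inf E.
have K0 : 0 <= K by apply: lb_le_inf; [exists (M ^+ 2)|move=> k []].
have KP u : l2norm (rho x u) ^+ 2 <= K * l2norm u ^+ 2.
  apply/ler_addgt0Pl => e e0.
  have c0 : 0 < l2norm u ^+ 2 + 1 by rewrite ltr_wpDl// sqr_ge0.
  have [k [k0 kP] kK] := inf_adherent (divr_gt0 e0 c0) infE.
  apply: le_trans (kP u) _.
  apply: (@le_trans _ _ ((K + e / (l2norm u ^+ 2 + 1)) * l2norm u ^+ 2)).
    by rewrite ler_wpM2r ?sqr_ge0// ltW.
  rewrite mulrDl addrC lerD2r mulrAC ler_pdivrMr//.
  by rewrite ler_wpM2l ?lerDl// ltW.
suff Kx : K <= cnorm x ^+ 2.
  move=> u; rewrite -(@ler_pXn2r _ 2)// ?nnegrE ?mulr_ge0 ?l2norm_ge0 ?cnorm_ge0//.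
  by apply: le_trans (KP u) _; rewrite exprMn ler_wpM2r ?sqr_ge0.
rewrite leNgt; apply/negP => xK.
have K_gt0 : 0 < K by apply: le_lt_trans xK; exact: sqr_ge0.
(* The adjoint obeys the same constant: |x^* v|^2 = <x x^* v, v> <= sqrt(K) |x^* v| |v|. *)
have starP v : l2norm (rho (star x) v) ^+ 2 <= K * l2norm v ^+ 2.
  have [v0|v0] := eqVneq (l2norm (rho (star x) v)) 0.
    by rewrite v0 expr0n /= mulr_ge0 ?sqr_ge0.
  have nv : 0 < l2norm (rho (star x) v) ^+ 2.
    by rewrite exprn_gt0// lt_def v0 l2norm_ge0.
  rewrite -(ler_pM2l nv); set w := rho (star x) v in v0 nv *.
  have -> : l2norm w ^+ 2 = complex.Re (dot (rho x w) v).
    by rewrite adj -/w dotxx.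
  apply: (@le_trans _ _ ((l2norm (rho x w) * l2norm v) ^+ 2)).
    have d0 : 0 <= complex.Re (dot (rho x w) v) by rewrite adj -/w dotxx /= sqr_ge0.
    by rewrite -expr2 lerXn2r ?nnegrE ?Re_dot_le// mulr_ge0 ?l2norm_ge0.
  rewrite adj -/w dotxx /= exprMn.
  have -> : l2norm w ^+ 2 * (K * l2norm v ^+ 2) =
    K * l2norm w ^+ 2 * l2norm v ^+ 2 by ring.
  by rewrite ler_wpM2r ?sqr_ge0.
(* The assumption |x|^2 < K is what gives |h| < 1. *)
pose h := (K^-1)%:C%C *: (star x * x).
have [y yh] : exists y, y * (1 - h) = 1.
  apply: neumann_left_inverse; rewrite /h cnormZ cnorm_star /= expr0n addr0 sqrtr_sqr.
  by rewrite ger0_norm ?invr_ge0// mulrC ltr_pdivrMr// mul1r.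
have [_ [L0 _ yL0]] := (bounded_opP (rho y)).1 (bnd y).
(* L >= 1 keeps K (1 - L^-2) nonnegative, as membership in [E] demands. *)
pose L := Num.max L0 1.
have L1 : 1 <= L by rewrite le_max lexx orbT.
have L_gt0 : 0 < L by apply: lt_le_trans L1.
have yL : norm_bound (rho y) L by apply: norm_boundW yL0; rewrite le_max lexx.
have rhoh u : rho (1 - h) u = u - (K^-1)%:C%C *: rho (star x) (rho x u).
  have -> : 1 - h = (- (K^-1)%:C%C) *: (star x * x) + 1 by rewrite scaleNr addrC.
  by rewrite lin one mul scaleNr addrC.
(* A left inverse bounded by L gives |u| <= L |u - x^* x u / K|; the square is expanded, and [starP]
   at x u absorbs its last term. *)
have low u :
  l2norm u ^+ 2 <= L ^+ 2 * (l2norm u ^+ 2 - K^-1 * l2norm (rho x u) ^+ 2).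
  have : l2norm u ^+ 2 <= L ^+ 2 * l2norm (rho (1 - h) u) ^+ 2.
    rewrite -exprMn lerXn2r ?nnegrE ?mulr_ge0 ?l2norm_ge0//; first exact: ltW.
    by have := yL (rho (1 - h) u); rewrite -mul yh one.
  move=> /le_trans; apply; rewrite ler_pM2l ?exprn_gt0// rhoh l2norm_sqB.
  have -> : complex.Re (dot u (rho (star x) (rho x u))) = l2norm (rho x u) ^+ 2.
    by rewrite -adj dotxx.
  have := starP (rho x u); set a := l2norm (rho (star x) _) ^+ 2.
  set b := l2norm (rho x u) ^+ 2; set c := l2norm u ^+ 2 => aKb.
  have : K^-1 ^+ 2 * a <= K^-1 ^+ 2 * (K * b) by rewrite ler_wpM2l ?sqr_ge0.
  have -> : K^-1 ^+ 2 * (K * b) = K^-1 * b by field; rewrite gt_eqF.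
  by lra.
(* Solved for |x u|^2, [low] yields an admissible constant strictly below the infimum K. *)
have EL : E (K * (1 - L^-1 ^+ 2)).
  have Li : L^-1 ^+ 2 <= 1 by rewrite exprVn invf_le1 ?exprn_gt0// expr_ge1// ltW.
  split=> [|u]; first by rewrite mulr_ge0// subr_ge0.
  have := low u; rewrite -(ler_pdivrMl _ _ (exprn_gt0 2 L_gt0)) => lo.
  rewrite -(ler_pM2l (x := K^-1)) ?invr_gt0// !mulrA mulVf ?gt_eqF// mul1r.
  by rewrite exprVn; lra.
have := ge_inf infE.2 EL; rewrite -/K leNgt => /negP; apply.
rewrite gtr_pMr// gtrBl exprn_gt0// invr_gt0//.
Qed.

End Contractivity.

(** * Diagonal operators and partial isometries *)

Section WeightedPullback.
Context {R : realType}.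
Local Notation C := R[i].
Implicit Types I J : choiceType.

Definition partial_inj I J (tau : J -> option I) :=
  forall l l', tau l -> tau l = tau l' -> l = l'.

Definition bounded_weight J (c : J -> R) := exists M, forall l, `|c l| <= M.

(** [insubd] returns 0 when the weighted family is not square summable; a bounded weight and a
    partially injective [tau] exclude that case ([weighted_pullE]). *)
Definition weighted_pull I J (c : J -> R) (tau : J -> option I) (x : ell2 R I) :
    ell2 R J :=
  insubd 0 (fun l => (c l)%:C%C * oapp x 0 (tau l)).

(** Injectivity where [tau] is defined means that each coordinate of x is read at most once. *)
Lemma weighted_pull_mass I J (c : J -> R) M (tau : J -> option I) (x : ell2 R I) :
  (forall l, `|c l| <= M) -> partial_inj tau ->
  (l2mass (fun l => (c l)%:C%C * oapp x 0 (tau l))%R <= (M ^+ 2)%:E * l2mass x)%E.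
Proof.
move=> cM inj.
pose h (o : option I) : R := oapp (fun k => normc (x k) ^+ 2) 0 o.
have h0 o : 0 <= h o by case: o => //= k; exact: sqr_ge0.
have h0E o : (0 <= (h o)%:E)%E by rewrite lee_fin.
apply: (@le_trans _ _ (\esum_(l in [set: J]) (M ^+ 2 * h (tau l))%:E)%E).
  apply: le_esum => l _; rewrite lee_fin normcM exprMn.
  have -> : normc (oapp x 0 (tau l)) ^+ 2 = h (tau l).
    by case: (tau l) => [k|]//; rewrite /h /oapp normc0 expr0n.
  rewrite ler_wpM2r// /= expr0n addr0 sqrtr_sqr.
  by rewrite lerXn2r ?nnegrE//; apply: le_trans (cM l).
apply: le_trans (le_esumZ (sqr_ge0 _) _) _ => [l|]; first exact: h0.
apply: lee_wpmul2l; first by rewrite lee_fin sqr_ge0.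
rewrite (@esumID _ _ [set l | tau l])//.
rewrite [X in (_ + X)%E]esum1 ?adde0; last first.
  by move=> l [_ /=]; case: (tau l).
rewrite setTI -(esum_image _ tau (fun o => (h o)%:E)); last first.
  by move=> l l' /set_mem tl _ /inj; exact.
have -> : l2mass x = (\esum_(o in Some @` [set: I]) (h o)%:E)%E.
  by rewrite esum_image// => k k' _ _ [].
rewrite esum_mkcond [leRHS]esum_mkcond; apply: le_esum => o _.
case: ifPn => [/set_mem[l /= tl <-]|_]; last by case: ifP.
by rewrite ifT//; apply/mem_set; case: (tau l) tl => // k _; exists k.
Qed.

Section Bounded.
Variables (I J : choiceType) (c : J -> R) (tau : J -> option I).
Hypotheses (bc : bounded_weight c) (inj : partial_inj tau).

Lemma weighted_pullE (x : ell2 R I) l :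
  weighted_pull c tau x l = (c l)%:C%C * oapp x 0 (tau l).
Proof.
rewrite /weighted_pull insubdK// inE.
have [M cM] := bc; apply: le_lt_trans (weighted_pull_mass x cM inj) _.
by rewrite l2normE -EFinM ltry.
Qed.

Lemma weighted_pull_bound M : 0 <= M -> (forall l, `|c l| <= M) ->
  norm_bound (weighted_pull c tau) M.
Proof.
move=> M0 cM x; apply: l2norm_le; first by rewrite mulr_ge0 ?l2norm_ge0.
rewrite exprMn EFinM -l2normE; apply: le_trans (weighted_pull_mass x cM inj).
by rewrite le_eqVlt; apply/orP; left; apply/eqP; congr l2mass; apply/funext => l;
  exact: weighted_pullE.
Qed.

Lemma weighted_pull_bounded : bounded_op (weighted_pull c tau).
Proof.
have [M cM] := bc; apply/bounded_opP; split.
  move=> d x y; apply: ell2_ext => l.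
  rewrite weighted_pullE ell2_coordD ell2_coordZ !weighted_pullE.
  by case: (tau l) => [k|]; rewrite /oapp ?ell2_coordD ?ell2_coordZ; ring.
exists `|M|; first exact: normr_ge0.
by apply: weighted_pull_bound => // l; apply: le_trans (cM l) (ler_norm _).
Qed.

End Bounded.

Definition diag_op J (c : J -> R) : ell2 R J -> ell2 R J :=
  weighted_pull c Some.

Lemma partial_inj_Some J : @partial_inj J J Some.
Proof. by move=> l l' _ []. Qed.
Local Hint Resolve partial_inj_Some : core.

Lemma diag_opE J (c : J -> R) x l : bounded_weight c ->
  diag_op c x l = (c l)%:C%C * x l.
Proof. by move=> bc; rewrite weighted_pullE. Qed.

Lemma diag_op_bounded J (c : J -> R) : bounded_weight c -> bounded_op (diag_op c).
Proof. by move=> bc; exact: weighted_pull_bounded. Qed.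

Lemma diag_op_basis J (c : J -> R) k : bounded_weight c ->
  diag_op c (ell2_basis k) = (c k)%:C%C *: ell2_basis k.
Proof.
move=> bc; apply: ell2_ext => l; rewrite diag_opE// ell2_coordZ !ell2_basisE.
by case: eqVneq => [->|]//; rewrite !mulr0.
Qed.

Lemma diag_op_adjoint J (c : J -> R) : bounded_weight c ->
  is_adjoint (diag_op c) (diag_op c).
Proof.
move=> bc; apply: is_adjoint_basis; try exact: diag_op_bounded.
move=> j k; rewrite !diag_opE// !ell2_basisE rmorphM/= oppr0 conjc_nat.
by rewrite eq_sym; case: eqVneq => [->|]//; rewrite !mulr0.
Qed.

Definition pull I J (tau : J -> option I) : ell2 R I -> ell2 R J :=
  weighted_pull (fun=> 1) tau.

Lemma bounded_weight_cst J (d : R) : bounded_weight (fun _ : J => d).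
Proof. by exists `|d|. Qed.

Section PartialBijection.
Variables (I J : choiceType) (tau : J -> option I) (sigma : I -> option J).
Hypothesis st : forall k l, (tau l == Some k) = (sigma k == Some l).

Lemma partial_bij_inj : partial_inj tau.
Proof.
move=> l l'; case tl: (tau l) => [k|]// _ /esym/eqP; rewrite st => /eqP tk.
by have /eqP := tl; rewrite st tk => /eqP[].
Qed.

Let bw := @bounded_weight_cst J 1.

Lemma pullE (x : ell2 R I) l : pull tau x l = oapp x 0 (tau l).
Proof. by rewrite weighted_pullE ?mul1r//; exact: partial_bij_inj. Qed.

Lemma pull_bounded : bounded_op (pull tau).
Proof. by apply: weighted_pull_bounded; [exact: bw|exact: partial_bij_inj]. Qed.

(** Pulling back along [tau] pushes basis vectors along its partial inverse [sigma]; so the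
    unilateral shift is the pullback along the predecessor. *)
Lemma pull_basis k : pull tau (ell2_basis k) = oapp (@ell2_basis R J) 0 (sigma k).
Proof.
apply: ell2_ext => l; rewrite pullE.
have := st k l; case: (tau l) (sigma k) => [k'|] [l'|]; rewrite /= /delta_fun.
- by rewrite !(inj_eq Some_inj) [l == _]eq_sym => ->.
- by rewrite (inj_eq Some_inj) => ->.
- by rewrite (inj_eq Some_inj) [l == _]eq_sym => <-.
- by [].
Qed.

End PartialBijection.

Lemma pull_adjoint I J (tau : J -> option I) (sigma : I -> option J) :
  (forall k l, (tau l == Some k) = (sigma k == Some l)) ->
  is_adjoint (pull tau) (pull sigma).
Proof.
move=> st; have st' k l : (sigma l == Some k) = (tau k == Some l) by rewrite st.
apply: is_adjoint_basis; first exact: pull_bounded st.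
  exact: pull_bounded st'.
move=> k l; rewrite (pullE st) (pull_basis st').
case: (tau l) => [k'|] /=; last by rewrite oppr0.
by rewrite /delta_fun conjc_nat eq_sym.
Qed.

End WeightedPullback.

(** * The Toeplitz algebra *)

Section Toeplitz.
Context {R : realType}.
Local Notation C := R[i].

Lemma bounded_op_cstar (I : choiceType) :
  cstar_subalg [set T : ell2 R I -> ell2 R I | bounded_op T].
Proof.
split=> //.
- by split=> [|c T T' bT bT']; [exact: bounded_op0|exact: bounded_op_lincomb].
- by move=> T T' bT bT'; exact: bounded_op_comp.
- by move=> T [].
Qed.

Lemma opnorm_closureS (I : choiceType) (X Y : set (ell2 R I -> ell2 R I)) :
  X `<=` Y -> opnorm_closure X `<=` opnorm_closure Y.
Proof.
move=> XY T [bT TX]; split=> // e /TX[T' /XY YT' h]; by exists T'.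
Qed.

(** [smallest] is an intersection, and each closure property passes to intersections. Boundedness of
    the generators puts the algebra of all bounded operators among the sets intersected. *)
Lemma cstar_subalg_smallest (I : choiceType) (G : set (ell2 R I -> ell2 R I)) :
  G `<=` [set T | bounded_op T] -> cstar_subalg (smallest (@cstar_subalg R I) G).
Proof.
move=> Gb; split.
- exact: smallest_sub (bounded_op_cstar I) Gb.
- split=> [|c T T' hT hT'] X [cX GX].
    by case: (cX) => _ [].
  by case: (cX) => _ [_ lin] _ _ _; apply: lin; [exact: hT|exact: hT'].
- move=> T T' hT hT' X [cX GX]; case: (cX) => _ _ mul _ _.
  by apply: mul; [exact: hT|exact: hT'].
- move=> T T' hT bT' TT' X [cX GX]; case: (cX) => _ _ _ st _.
  by apply: (st T) => //; exact: hT.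
- move=> T hT X [cX GX]; case: (cX) => _ _ _ _; apply.
  by apply: opnorm_closureS hT => S; apply.
Qed.

Lemma toeplitz_cstar : cstar_subalg (@toeplitz R).
Proof. by apply: cstar_subalg_smallest => T []. Qed.

Lemma toeplitz_bounded T : @toeplitz R T -> bounded_op T.
Proof. by case: toeplitz_cstar => h _ _ _ _; exact: h. Qed.

Lemma toeplitz_lincomb (c : C) S T : @toeplitz R S -> toeplitz T ->
  toeplitz (fun x => c *: S x + T x).
Proof. by case: toeplitz_cstar => _ [_ h] _ _ _; exact: h. Qed.

Lemma toeplitz_comp S T : @toeplitz R S -> toeplitz T -> toeplitz (S \o T).
Proof. by case: toeplitz_cstar => _ _ h _ _; exact: h. Qed.

Definition succ_opt (n : nat) : option nat := Some n.+1.
Definition pred_opt (n : nat) : option nat := if n is n'.+1 then Some n' else None.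

Lemma pred_succ_opt (k l : nat) : (pred_opt l == Some k) = (succ_opt k == Some l).
Proof.
by case: l => [|l] //=; rewrite !(inj_eq Some_inj) [RHS]eqSS eq_sym.
Qed.

Lemma succ_pred_opt (k l : nat) : (succ_opt l == Some k) = (pred_opt k == Some l).
Proof. by rewrite pred_succ_opt. Qed.

Definition shift_op : ell2 R nat -> ell2 R nat := pull pred_opt.
Definition coshift_op : ell2 R nat -> ell2 R nat := pull succ_opt.

Lemma shift_bounded : bounded_op shift_op.
Proof. exact: pull_bounded pred_succ_opt. Qed.

Lemma coshift_bounded : bounded_op coshift_op.
Proof. exact: pull_bounded succ_pred_opt. Qed.

Lemma shift_adjoint : is_adjoint shift_op coshift_op.
Proof. exact: pull_adjoint pred_succ_opt. Qed.

Lemma shift_toeplitz : toeplitz shift_op.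
Proof.
move=> X [_ GX]; apply: GX; split=> [|k]; first exact: shift_bounded.
by rewrite /shift_op (pull_basis pred_succ_opt).
Qed.

Lemma coshift_toeplitz : toeplitz coshift_op.
Proof.
case: toeplitz_cstar => _ _ _ h _; apply: h shift_toeplitz _ shift_adjoint.
exact: coshift_bounded.
Qed.

(** [cstar_subalg] does not ask for a unit; here it comes from S^* S = 1. *)
Lemma id_toeplitz : toeplitz (@id (ell2 R nat)).
Proof.
have -> : @id (ell2 R nat) = coshift_op \o shift_op.
  apply/funext => x; apply: ell2_ext => k /=.
  by rewrite (pullE succ_pred_opt) /= (pullE pred_succ_opt).
exact: toeplitz_comp coshift_toeplitz shift_toeplitz.
Qed.

Lemma diag_toeplitz_tail N : toeplitz (diag_op (fun n => ((N <= n)%N)%:R : R)).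
Proof.
have bw M : bounded_weight (fun n => ((M <= n)%N)%:R : R).
  by exists 1 => n; rewrite normr_nat lern1 leq_b1.
elim: N => [|N IHN].
  have -> : diag_op (fun n => (0 <= n)%N%:R : R) = id; last exact: id_toeplitz.
  by apply/funext => x; apply: ell2_ext => k; rewrite diag_opE// leq0n mul1r.
have -> : diag_op (fun n => (N.+1 <= n)%N%:R : R) =
    shift_op \o (diag_op (fun n => (N <= n)%N%:R : R) \o coshift_op).
  apply/funext => x; apply: ell2_ext => k.
  rewrite diag_opE// (pullE pred_succ_opt); case: k => [|k]/=.
    by rewrite mul0r.
  by rewrite diag_opE// (pullE succ_pred_opt).
by apply: toeplitz_comp shift_toeplitz _; apply: toeplitz_comp IHN coshift_toeplitz.
Qed.

(* The projections S^N S^*^N onto the tails give all the diagonal operators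
   with eventually constant weights. *)
Lemma diag_toeplitz (d : nat -> R) (l : R) :
  d n @[n --> \oo] --> l -> toeplitz (diag_op d).
Proof.
move=> dl.
pose d' N n := if (n < N)%N then d n else l.
have bd' N : bounded_weight (d' N).
  exists (`|l| + \sum_(i < N) `|d i|) => n; rewrite /d'; case: ifPn => nN.
    by rewrite (bigD1 (Ordinal nN))//= addrCA lerDl addr_ge0// sumr_ge0.
  by rewrite lerDl sumr_ge0.
have bw M : bounded_weight (fun n => ((M <= n)%N)%:R : R).
  by exists 1 => n; rewrite normr_nat lern1 leq_b1.
have d'T N : toeplitz (diag_op (d' N)).
  elim: N => [|N IHN].
    have -> : diag_op (d' 0%N) = fun x => l%:C%C *: id x + 0.
      by apply/funext => x; apply: ell2_ext => k; rewrite diag_opE// addr0 /d' ltn0.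
    apply: toeplitz_lincomb id_toeplitz _.
    by case: toeplitz_cstar => _ [].
  pose c := d N - l.
  (* The difference of the two tail projections is the projection onto e_N, where the weight has to
     change from l to d N. *)
  have -> : diag_op (d' N.+1) = fun x => c%:C%C *: diag_op (fun n => (N <= n)%N%:R) x +
     ((- c)%:C%C *: diag_op (fun n => (N.+1 <= n)%N%:R) x + diag_op (d' N) x).
    apply/funext => x; apply: ell2_ext => k.
    rewrite diag_opE// !ell2_coordD !ell2_coordZ !diag_opE// !mulrA -!mulrDl.
    congr (_ * _); rewrite /d' ltnS; case: (ltngtP k N) => [kN|Nk|->].
    - by rewrite !mulr0 !add0r.
    - by rewrite !mulr1 rmorphN /= addNKr.
    - by rewrite mulr1 mulr0 add0r -rmorphD /= subrK.
  apply: toeplitz_lincomb; first exact: diag_toeplitz_tail.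
  by apply: toeplitz_lincomb => //; exact: diag_toeplitz_tail.
have dist N e : (forall n, (N <= n)%N -> `|l - d n| < e) ->
    forall n, `|d n - d' N n| <= e.
  move=> NP n; rewrite /d'; case: ltnP => [nN|/NP]; last by rewrite distrC => /ltW.
  rewrite subrr normr0; apply: le_trans (ltW (NP N (leqnn N))); exact: normr_ge0.
have bd : bounded_weight d.
  have /cvgrPdist_lt/(_ 1 ltr01)[N _ NP] := dl.
  have [M MP] := bd' N; exists (1 + M) => n; rewrite -(subrK (d' N n) (d n)).
  apply: le_trans (ler_normD _ _) _; apply: lerD => //.
  exact: dist.
case: toeplitz_cstar => _ _ _ _; apply; split; first exact: diag_op_bounded.
move=> e e0; have /cvgrPdist_lt/(_ _ e0)[N _ NP] := dl.
exists (diag_op (d' N)) => //; apply/norm_boundP.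
have -> : (fun x => diag_op d x - diag_op (d' N) x) = diag_op (fun n => d n - d' N n).
  have bB : bounded_weight (fun n => d n - d' N n) by exists e; exact: dist.
  apply/funext => x; apply: ell2_ext => k; rewrite ell2_coordB !diag_opE//.
  by rewrite rmorphB mulrBl.
have bB : bounded_weight (fun n => d n - d' N n) by exists e; exact: dist.
apply: weighted_pull_bound => //; [by move=> ? ? _ []|exact: ltW|exact: dist].
Qed.

End Toeplitz.

(** * Compact operators *)

Section Compact.
Context {R : realType}.
Local Notation C := R[i].
Implicit Types I J : choiceType.

(** Any compact set containing the image of the unit ball will do, because compact sets are closed
    here; continuous images of compact sets can thus replace closures. *)
Lemma compact_opP I (B : ell2 R I -> ell2 R I) : bounded_op B ->
  (exists2 K, compact K & forall x, l2norm x <= 1 -> K (B x)) -> compact_op B.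
Proof.
move=> bB [K cK BK]; split=> //.
apply: (subclosed_compact _ cK); first exact: closed_closure.
have clK : closed K by apply: compact_closed => //; exact: norm_hausdorff.
rewrite [X in _ `<=` X]((closure_id _).1 clK); apply: closure_subset.
by move=> _ [x /= x1 <-]; apply: BK; move: x1; rewrite ell2_normE lecR.
Qed.

Lemma compact_op_image I (B : ell2 R I -> ell2 R I) : compact_op B ->
  exists2 K, compact K & forall x, l2norm x <= 1 -> K (B x).
Proof.
move=> [_ cB]; eexists; first exact: cB.
move=> x x1; apply: subset_closure; exists x => //=.
by rewrite ell2_normE lecR.
Qed.

Lemma bounded_op_continuous I J (T : ell2 R I -> ell2 R J) :
  bounded_op T -> continuous T.
Proof.
move=> /bounded_opP[lT [M M0 TM]] x.
apply/(@cvgrPdist_lt C (ell2 R J) (ell2 R I) (nbhs x) (nbhs_filter x)).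
move=> e /complex_gt0[-> e0]; set r := complex.Re e in e0 *.
have M1 : 0 < M + 1 by rewrite ltr_wpDl.
apply/nbhs_normP; exists (r / (M + 1))%:C%C; first by rewrite /= ltcR divr_gt0.
move=> y /=; rewrite -(linB lT) !ell2_normE !ltcR ltr_pdivlMr// => xy.
apply: le_lt_trans (TM _) _; apply: le_lt_trans xy.
by rewrite mulrC ler_wpM2l ?l2norm_ge0// lerDl.
Qed.

Lemma compact_op_bounded I (B : ell2 R I -> ell2 R I) : compact_op B -> bounded_op B.
Proof. by case. Qed.

Lemma compact_op_compl I (T B : ell2 R I -> ell2 R I) :
  bounded_op T -> compact_op B -> compact_op (T \o B).
Proof.
move=> bT cB; apply: compact_opP.
  by apply: bounded_op_comp => //; exact: compact_op_bounded.
have [K cK BK] := compact_op_image cB; exists (T @` K).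
  apply: continuous_compact => //; apply: continuous_subspaceT.
  exact: bounded_op_continuous.
by move=> x /BK KBx; exists (B x).
Qed.

Lemma compact_op_compr I (T B : ell2 R I -> ell2 R I) :
  bounded_op T -> compact_op B -> compact_op (B \o T).
Proof.
move=> bT cB; have bB := compact_op_bounded cB.
have /bounded_opP[lT [M M0 TM]] := bT.
have M1 : 0 < M + 1 by rewrite ltr_wpDl.
apply: compact_opP; first exact: bounded_op_comp.
have [K cK BK] := compact_op_image cB.
pose S (y : ell2 R I) := (M + 1)%:C%C *: y.
exists (S @` K).
  apply: continuous_compact => //; apply: continuous_subspaceT.
  by apply: bounded_op_continuous; apply: bounded_opZ; exact: bounded_op_id.
(* T x / (M + 1) lies in the unit ball, so B (T x) lies in (M + 1) K. *)
move=> x x1; exists (B ((M + 1)^-1%:C%C *: T x)).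
  apply: BK; rewrite l2normZ /= expr0n addr0 sqrtr_sqr ger0_norm ?invr_ge0 ?(ltW M1)//.
  rewrite mulrC ler_pdivrMr// mul1r; apply: le_trans (TM x) _.
  apply: le_trans (ler_wpM2l M0 x1) _; rewrite mulr1 lerDl//.
rewrite /S (linZ (bounded_op_linear bB)) scalerA -rmorphM /= divff ?scale1r//.
by rewrite gt_eqF.
Qed.

Lemma compact_opZ I (c : C) (B : ell2 R I -> ell2 R I) : compact_op B ->
  compact_op (fun x => c *: B x).
Proof.
move=> cB; apply: (@compact_op_compl _ (fun x => c *: x)) => //.
by apply: bounded_opZ; exact: bounded_op_id.
Qed.

Lemma l2norm_basis I (j : I) : l2norm (ell2_basis j : ell2 R I) = 1.
Proof.
have /complexI : (l2norm (ell2_basis j : ell2 R I) ^+ 2)%:C%C = 1%:C%C.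
  by rewrite -dotxx dot_basisr ell2_basisE eqxx.
by move=> /eqP; rewrite sqrp_eq1 ?l2norm_ge0// => /eqP.
Qed.

Lemma normc_le_ReIm (a b : R) : normc (a +i* b)%C <= `|a| + `|b|.
Proof.
have -> : (a +i* b)%C = (a%:C + (0 +i* b))%C.
  by apply/eqP; rewrite eq_complex /= addr0 add0r !eqxx.
by apply: le_trans (le_normcD _ _) _; rewrite /= expr0n addr0 add0r !sqrtr_sqr.
Qed.

Lemma ReIm_le_normc (z : C) : `|complex.Re z| <= normc z /\ `|complex.Im z| <= normc z.
Proof.
case: z => a b /=; rewrite -!sqrtr_sqr.
by split; apply: ler_wsqrtr; rewrite ?lerDl ?lerDr sqr_ge0.
Qed.

Definition unit_diag I (j : I) : ell2 R I -> ell2 R I :=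
  diag_op (fun i => (i == j)%:R).

Lemma bounded_weight_eq I (j : I) : bounded_weight (fun i => (i == j)%:R : R).
Proof. by exists 1 => i; rewrite normr_nat lern1 leq_b1. Qed.

Lemma compact_unit_diag I (j : I) : compact_op (unit_diag j).
Proof.
apply: compact_opP; first by apply: diag_op_bounded; exact: bounded_weight_eq.
(* A square of real parameters contains the complex unit disc and is compact as a product of
   segments. *)
pose f (p : R * R) : ell2 R I := (p.1 +i* p.2)%C *: ell2_basis j.
exists (f @` (`[-1, 1] `*` `[-1, 1])%classic).
  apply: continuous_compact; last by apply: compact_setX; exact: segment_compact.
  apply: continuous_subspaceT => -[a b].
  apply/cvgrPdist_lt => e /complex_gt0[-> e0]; set r := complex.Re e in e0 *.
  have r20 : 0 < r / 2 by rewrite divr_gt0.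
  near=> p.
  have pa : `|a - p.1| < r / 2.
    by near: p; apply: cvgr_dist_lt => //; exact: cvg_fst.
  have pb : `|b - p.2| < r / 2.
    by near: p; apply: cvgr_dist_lt => //; exact: cvg_snd.
  rewrite ell2_normE ltcR /f -scalerBl l2normZ.
  rewrite l2norm_basis mulr1; apply: le_lt_trans (normc_le_ReIm _ _) _.
  by rewrite -/r (splitr r) ltrD.
move=> x x1; have [Re_x Im_x] := ReIm_le_normc (x j).
have xj1 : normc (x j) <= 1 by apply: le_trans x1; exact: le_normc_l2norm.
exists (complex.Re (x j), complex.Im (x j)).
  by split; rewrite /= in_itv /= -ler_norml; apply: le_trans xj1.
apply: ell2_ext => i; rewrite /f diag_opE; last exact: bounded_weight_eq.
rewrite ell2_coordZ ell2_basisE; case: eqVneq => [->|_].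
  by rewrite mulr1 mul1r; case: (x j).
by rewrite mulr0 mul0r.
Unshelve. all: by end_near.
Qed.

End Compact.

(** * Tensor products *)

Section Tensor.
Context {R : realType}.
Local Notation C := R[i].
Implicit Types I J : choiceType.

Lemma tensor_vec_basis I J (i : I) (j : J) :
  tensor_vec (ell2_basis i) (ell2_basis j) = ell2_basis (i, j) :> ell2 R _.
Proof.
apply: ell2_ext => -[i' j']; rewrite ell2_basisE /= /delta_fun -natrM mulnb.
by rewrite xpair_eqE.
Qed.

Section Operators.
Variables (I J : choiceType).
Implicit Types (A : ell2 R I -> ell2 R I) (B : ell2 R J -> ell2 R J).

Lemma optensor_bounded A B : bounded_op A -> bounded_op B ->
  bounded_op (optensor A B).
Proof. by move=> bA bB; case: (optensorP bA bB). Qed.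

Lemma optensorE A B u v : bounded_op A -> bounded_op B ->
  optensor A B (tensor_vec u v) = tensor_vec (A u) (B v).
Proof. by move=> bA bB; case: (optensorP bA bB). Qed.

Lemma optensor_basis A B i j : bounded_op A -> bounded_op B ->
  optensor A B (ell2_basis (i, j)) = tensor_vec (A (ell2_basis i)) (B (ell2_basis j)).
Proof. by move=> bA bB; rewrite -tensor_vec_basis optensorE. Qed.

(** [optensor] is obtained by choice; it is computed by exhibiting a bounded operator with the right
    values on basis vectors. *)
Lemma optensor_eq A B T : bounded_op A -> bounded_op B -> bounded_op T ->
  (forall i j, T (ell2_basis (i, j)) =
    tensor_vec (A (ell2_basis i)) (B (ell2_basis j))) -> optensor A B = T.
Proof.
move=> bA bB bT TE; apply: bounded_op_eq => // [|[i j]]; first exact: optensor_bounded.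
by rewrite optensor_basis.
Qed.

Lemma optensor_comp A B A' B' : bounded_op A -> bounded_op B ->
  bounded_op A' -> bounded_op B' ->
  optensor A B \o optensor A' B' = optensor (A \o A') (B \o B').
Proof.
move=> bA bB bA' bB'; apply/esym/optensor_eq; try exact: bounded_op_comp.
  by apply: bounded_op_comp; exact: optensor_bounded.
by move=> i j /=; rewrite optensor_basis// optensorE.
Qed.

Lemma tensor_vecZl c (u : ell2 R I) (v : ell2 R J) :
  tensor_vec (c *: u) v = c *: tensor_vec u v.
Proof. by apply: ell2_ext => -[i j]; exact: (esym (mulrA c (u i) (v j))). Qed.

Lemma tensor_vecZr c (u : ell2 R I) (v : ell2 R J) :
  tensor_vec u (c *: v) = c *: tensor_vec u v.
Proof. by apply: ell2_ext => -[i j]; exact: (mulrCA (u i) c (v j)). Qed.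

Lemma tensor_vecDr (u : ell2 R I) (v w : ell2 R J) :
  tensor_vec u (v + w) = tensor_vec u v + tensor_vec u w.
Proof. by apply: ell2_ext => -[i j]; exact: (mulrDr (u i) (v j) (w j)). Qed.

Lemma optensorZr c A B : bounded_op A -> bounded_op B ->
  optensor A (fun x => c *: B x) = (fun x => c *: optensor A B x).
Proof.
move=> bA bB; apply: optensor_eq => //; first exact: bounded_opZ.
  by apply: bounded_opZ; exact: optensor_bounded.
by move=> i j; rewrite optensor_basis// tensor_vecZr.
Qed.

Lemma optensor_lincombr c A B B' : bounded_op A -> bounded_op B -> bounded_op B' ->
  optensor A (fun x => c *: B x + B' x) =
  (fun x => c *: optensor A B x + optensor A B' x).
Proof.
move=> bA bB bB'; apply: optensor_eq => //; first exact: bounded_op_lincomb.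
  by apply: bounded_op_lincomb; exact: optensor_bounded.
by move=> i j; rewrite !optensor_basis// tensor_vecDr tensor_vecZr.
Qed.

Lemma is_adjoint_conj (K L : choiceType) (T : ell2 R K -> ell2 R L) T' j k :
  is_adjoint T T' ->
  T (ell2_basis j) k = ((T' (ell2_basis k) j)^*)%C.
Proof. by move=> TT'; rewrite -dot_basisr TT' dot_basisl. Qed.

Lemma optensor_adjoint A B A' B' : bounded_op A -> bounded_op B ->
  bounded_op A' -> bounded_op B' -> is_adjoint A A' -> is_adjoint B B' ->
  is_adjoint (optensor A B) (optensor A' B').
Proof.
move=> bA bB bA' bB' AA' BB'.
apply: is_adjoint_basis; try exact: optensor_bounded.
move=> [i j] [i' j']; rewrite !optensor_basis//=.
by rewrite rmorphM /= -(is_adjoint_conj _ _ AA') -(is_adjoint_conj _ _ BB').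
Qed.

Lemma bounded_weightM (K L : choiceType) (a : K -> R) (b : L -> R) :
  bounded_weight a ->
  bounded_weight b -> bounded_weight (fun p : K * L => a p.1 * b p.2).
Proof.
move=> [M aM] [N bN]; exists (M * N) => -[k l] /=.
by rewrite normrM ler_pM.
Qed.

Lemma optensor_diag (a : I -> R) (b : J -> R) :
  bounded_weight a -> bounded_weight b ->
  optensor (diag_op a) (diag_op b) = diag_op (fun p : I * J => a p.1 * b p.2).
Proof.
move=> ba bb; have bab := bounded_weightM ba bb.
apply: optensor_eq; try exact: diag_op_bounded.
move=> i j; rewrite !diag_op_basis// tensor_vecZl tensor_vecZr tensor_vec_basis.
by rewrite scalerA -rmorphM.
Qed.

(** Boundedness of [optensor] comes without a constant. The identification with [amplification]
    keeps the constant of B, on which the continuity of D in its algebra argument rests. *)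
Lemma optensor_id_bound B (M : R) : bounded_op B -> 0 <= M -> norm_bound B M ->
  norm_bound (optensor (@id (ell2 R I)) B) M.
Proof.
move=> bB M0 /norm_boundP BM.
have idK : cancel (@id (I * J)) id by [].
have -> : optensor (@id (ell2 R I)) B = amplification idK idK bB.
  apply: optensor_eq => //; first exact: bounded_op_id.
    exact: amplification_bounded.
  move=> i j; apply: ell2_ext => -[i' j'] /=.
  have -> : slice idK idK (ell2_basis (i, j)) i' =
      (i' == i)%:R *: (ell2_basis j : ell2 R J).
    apply: ell2_ext => l; rewrite ell2_coordZ /= /delta_fun xpair_eqE.
    by rewrite -natrM mulnb.
  by rewrite (linZ (bounded_op_linear bB)).
move=> x; apply: l2norm_le; first by rewrite mulr_ge0 ?l2norm_ge0.
by rewrite exprMn EFinM -l2normE; exact: amplification_mass.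
Qed.

End Operators.

Section Closure.
Variable I : choiceType.
Implicit Types (X Y : set (ell2 R I -> ell2 R I)) (P S T : ell2 R I -> ell2 R I).

Lemma opnorm_closureP X T : opnorm_closure X T <-> bounded_op T /\
  forall e : R, 0 < e -> exists2 T', X T' & norm_bound (fun x => T x - T' x) e.
Proof.
by split=> -[bT TX]; split=> // e /TX[T' XT' h]; exists T' => //; apply/norm_boundP.
Qed.

Lemma sub_opnorm_closure X : X `<=` [set T | bounded_op T] -> X `<=` opnorm_closure X.
Proof.
move=> Xb T XT; apply/opnorm_closureP; split; first exact: Xb.
move=> e e0; exists T => // x; rewrite subrr l2norm0 mulr_ge0 ?l2norm_ge0//.
exact: ltW.
Qed.

Lemma opnorm_closure_idem X : opnorm_closure (opnorm_closure X) `<=` opnorm_closure X.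
Proof.
move=> T /opnorm_closureP[bT TX]; apply/opnorm_closureP; split=> // e e0.
have e20 : 0 < e / 2 by rewrite divr_gt0.
have [T' /opnorm_closureP[bT' T'X] TT'] := TX _ e20.
have [T'' XT'' T'T''] := T'X _ e20; exists T'' => // x.
rewrite -(subrK (T' x) (T x)) -addrA; apply: le_trans (ler_l2normD _ _) _.
by rewrite (splitr e) mulrDl lerD.
Qed.

Lemma opnorm_closure_lincomb X :
  (forall c S T, X S -> X T -> X (fun x => c *: S x + T x)) ->
  forall c S T, opnorm_closure X S -> opnorm_closure X T ->
    opnorm_closure X (fun x => c *: S x + T x).
Proof.
move=> Xlin c S T /opnorm_closureP[bS SX] /opnorm_closureP[bT TX].
apply/opnorm_closureP; split; first exact: bounded_op_lincomb.
move=> e e0; have e20 : 0 < e / 2 by rewrite divr_gt0.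
have c0 : 0 < normc c + 1 by rewrite ltr_wpDl// normc_ge0.
have [S' XS' SS'] := SX _ (divr_gt0 e20 c0); have [T' XT' TT'] := TX _ e20.
exists (fun x => c *: S' x + T' x); first exact: Xlin.
move=> x; rewrite opprD addrACA -scalerBr; apply: le_trans (ler_l2normD _ _) _.
rewrite (splitr e) mulrDl lerD// l2normZ.
apply: (@le_trans _ _ ((normc c + 1) * (e / 2 / (normc c + 1) * l2norm x))).
  by apply: ler_pM; rewrite ?normc_ge0 ?l2norm_ge0// lerDl.
by rewrite mulrA mulrC [_ * (e / 2 / _)]mulrC divfK ?gt_eqF// mulrC.
Qed.

Lemma opnorm_closure_compl X Y P : bounded_op P ->
  (forall T, X T -> Y (P \o T)) ->
  forall T, opnorm_closure X T -> opnorm_closure Y (P \o T).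
Proof.
move=> bP XY T /opnorm_closureP[bT TX]; apply/opnorm_closureP.
split; first exact: bounded_op_comp.
have /bounded_opP[lP [M M0 PM]] := bP.
move=> e e0; have M1 : 0 < M + 1 by rewrite ltr_wpDl.
have [T' XT' TT'] := TX _ (divr_gt0 e0 M1).
exists (P \o T'); first exact: XY.
move=> x /=; rewrite -(linB lP); apply: le_trans (PM _) _.
apply: (@le_trans _ _ ((M + 1) * (e / (M + 1) * l2norm x))).
  by apply: ler_pM; rewrite ?l2norm_ge0// lerDl.
by rewrite mulrA [_ * (e / _)]mulrC divfK ?gt_eqF.
Qed.

Lemma opnorm_closure_compr X Y P : bounded_op P ->
  (forall T, X T -> Y (T \o P)) ->
  forall T, opnorm_closure X T -> opnorm_closure Y (T \o P).
Proof.
move=> bP XY T /opnorm_closureP[bT TX]; apply/opnorm_closureP.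
split; first exact: bounded_op_comp.
have /bounded_opP[lP [M M0 PM]] := bP.
move=> e e0; have M1 : 0 < M + 1 by rewrite ltr_wpDl.
have [T' XT' TT'] := TX _ (divr_gt0 e0 M1).
exists (T' \o P); first exact: XY.
move=> x /=; apply: le_trans (TT' _) _.
apply: (@le_trans _ _ (e / (M + 1) * ((M + 1) * l2norm x))).
  rewrite ler_wpM2l ?divr_ge0 ?(ltW e0) ?(ltW M1)//; apply: le_trans (PM x) _.
  by rewrite ler_wpM2r ?l2norm_ge0 ?lerDl.
by rewrite mulrA divfK ?gt_eqF.
Qed.

End Closure.

End Tensor.

(** * The tensor product of the Toeplitz algebra and the compact operators *)

Section ToeplitzCompact.
Context {R : realType} {J : choiceType}.
Local Notation C := R[i].
Local Notation op := (ell2 R (nat * J)%type -> ell2 R (nat * J)%type).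

(** This is the set inside the closure in [spatial_tensor], so that [TK] unfolds to the closure of
    [Z]. *)
Definition tensor_sums : set op :=
  [set T | exists n (A : 'I_n -> ell2 R nat -> ell2 R nat)
      (B : 'I_n -> ell2 R J -> ell2 R J),
    [/\ forall k, toeplitz (A k), forall k, compact_op (B k) &
        T = fun x => \sum_(k < n) optensor (A k) (B k) x]].

Local Notation Z := tensor_sums.
Local Notation TK := (spatial_tensor (@toeplitz R) (@compact_op R J)).

Lemma tensor_sums0 : Z (fun=> 0).
Proof.
exists 0, (fun=> id), (fun=> id); split; [by case|by case|].
by apply/funext => x; rewrite big_ord0.
Qed.

Lemma tensor_sums_tensor A B : toeplitz A -> compact_op B -> Z (optensor A B).
Proof.
move=> tA cB; exists 1, (fun=> A), (fun=> B); split=> //.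
by apply/funext => x; rewrite big_ord1.
Qed.

Lemma tensor_sumsD S T : Z S -> Z T -> Z (fun x => S x + T x).
Proof.
move=> [n [A [B [tA cB ->]]]] [m [A' [B' [tA' cB' ->]]]].
exists (n + m)%N,
  (fun k => match fintype.split k with inl i => A i | inr i => A' i end),
  (fun k => match fintype.split k with inl i => B i | inr i => B' i end).
split=> [k|k|]; try by case: fintype.split.
apply/funext => x; rewrite big_split_ord.
have El (i : 'I_n) : fintype.split (lshift m i) = inl i := unsplitK (inl i).
have Er (i : 'I_m) : fintype.split (rshift n i) = inr i := unsplitK (inr i).
by congr (_ + _); apply: eq_bigr => i _; rewrite ?El ?Er.
Qed.

Lemma tensor_sums_sum n (T : 'I_n -> op) : (forall k, Z (T k)) ->
  Z (fun x => \sum_(k < n) T k x).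
Proof.
elim: n T => [|n IHn] T ZT.
  have -> : (fun x => \sum_(k < 0) T k x) = (fun=> 0).
    by apply/funext => x; rewrite big_ord0.
  exact: tensor_sums0.
have -> : (fun x => \sum_(k < n.+1) T k x) =
    (fun x => \sum_(k < n) T (widen_ord (leqnSn n) k) x + T ord_max x).
  by apply/funext => x; rewrite big_ord_recr.
by apply: tensor_sumsD => //; exact: IHn.
Qed.

Lemma tensor_sums_bounded T : Z T -> bounded_op T.
Proof.
move=> [n [A [B [tA cB ->]]]]; elim: n A B tA cB => [|n IHn] A B tA cB.
  have -> : (fun x => \sum_(k < 0) optensor (A k) (B k) x) = (fun=> 0).
    by apply/funext => x; rewrite big_ord0.
  exact: bounded_op0.
have -> : (fun x => \sum_(k < n.+1) optensor (A k) (B k) x) =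
    (fun x => optensor (A ord0) (B ord0) x +
      \sum_(k < n) optensor (A (lift ord0 k)) (B (lift ord0 k)) x).
  by apply/funext => x; rewrite big_ord_recl.
apply: bounded_opD; last by apply: IHn => k.
by apply: optensor_bounded; [exact: toeplitz_bounded|exact: compact_op_bounded].
Qed.

Lemma tensor_sums_lincomb c S T : Z S -> Z T -> Z (fun x => c *: S x + T x).
Proof.
move=> [n [A [B [tA cB ->]]]] ZT; apply: tensor_sumsD => //.
have -> : (fun x => c *: \sum_(k < n) optensor (A k) (B k) x) =
    (fun x => \sum_(k < n) optensor (A k) (fun y => c *: B k y) x).
  apply/funext => x; rewrite scaler_sumr; apply: eq_bigr => k _.
  by rewrite optensorZr//; [exact: toeplitz_bounded|exact: compact_op_bounded].
by apply: tensor_sums_sum => k; apply: tensor_sums_tensor => //; exact: compact_opZ.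
Qed.

Lemma tensor_sums_compl P Q T :
  toeplitz P -> bounded_op Q -> Z T -> Z (optensor P Q \o T).
Proof.
move=> tP bQ [n [A [B [tA cB ->]]]]; have bP := toeplitz_bounded tP.
have lPQ := bounded_op_linear (optensor_bounded bP bQ).
have -> : optensor P Q \o (fun x => \sum_(k < n) optensor (A k) (B k) x) =
    (fun x => \sum_(k < n) optensor (P \o A k) (Q \o B k) x).
  apply/funext => x /=; rewrite (lin_sum lPQ); apply: eq_bigr => k _.
  by rewrite -optensor_comp//; [exact: toeplitz_bounded|exact: compact_op_bounded].
apply: tensor_sums_sum => k; apply: tensor_sums_tensor; first exact: toeplitz_comp.
exact: compact_op_compl.
Qed.

Lemma tensor_sums_compr P Q T :
  toeplitz P -> bounded_op Q -> Z T -> Z (T \o optensor P Q).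
Proof.
move=> tP bQ [n [A [B [tA cB ->]]]]; have bP := toeplitz_bounded tP.
have -> : (fun x => \sum_(k < n) optensor (A k) (B k) x) \o optensor P Q =
    (fun x => \sum_(k < n) optensor (A k \o P) (B k \o Q) x).
  apply/funext => x /=; apply: eq_bigr => k _.
  by rewrite -optensor_comp//; [exact: toeplitz_bounded|exact: compact_op_bounded].
apply: tensor_sums_sum => k; apply: tensor_sums_tensor; first exact: toeplitz_comp.
exact: compact_op_compr.
Qed.

Lemma tensor_sums_comp S T : Z S -> Z T -> Z (S \o T).
Proof.
move=> [n [A [B [tA cB ->]]]] ZT.
apply: (tensor_sums_sum (T := fun k x => optensor (A k) (B k) (T x))) => k.
by apply: tensor_sums_compl => //; exact: compact_op_bounded.
Qed.

Lemma toeplitz_compact_bounded T : TK T -> bounded_op T.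
Proof. by case. Qed.

Lemma toeplitz_compact_sums T : Z T -> TK T.
Proof. exact: (sub_opnorm_closure tensor_sums_bounded). Qed.

Lemma toeplitz_compact_closed : opnorm_closure TK `<=` TK.
Proof. exact: opnorm_closure_idem. Qed.

Lemma toeplitz_compact_lincomb c S T : TK S -> TK T -> TK (fun x => c *: S x + T x).
Proof. by apply: opnorm_closure_lincomb => d S' T'; exact: tensor_sums_lincomb. Qed.

Lemma toeplitz_compactD S T : TK S -> TK T -> TK (fun x => S x + T x).
Proof.
move=> kS kT; have := toeplitz_compact_lincomb 1 kS kT.
by congr TK; apply/funext => x; rewrite scale1r.
Qed.

Lemma toeplitz_compact_compl P Q T :
  toeplitz P -> bounded_op Q -> TK T -> TK (optensor P Q \o T).
Proof.
move=> tP bQ; apply: opnorm_closure_compl.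
  by apply: optensor_bounded => //; exact: toeplitz_bounded.
by move=> T'; exact: tensor_sums_compl.
Qed.

Lemma toeplitz_compact_compr P Q T :
  toeplitz P -> bounded_op Q -> TK T -> TK (T \o optensor P Q).
Proof.
move=> tP bQ; apply: opnorm_closure_compr.
  by apply: optensor_bounded => //; exact: toeplitz_bounded.
by move=> T'; exact: tensor_sums_compr.
Qed.

(** One factor is approximated at a time, S and then T, which puts the product in the closure of the
    closed set [TK]. *)
Lemma toeplitz_compact_comp S T : TK S -> TK T -> TK (S \o T).
Proof.
move=> kS kT; have bT := toeplitz_compact_bounded kT.
apply: toeplitz_compact_closed; apply: (opnorm_closure_compr bT) kS => S' zS'.
have bS' := tensor_sums_bounded zS'.
by apply: (opnorm_closure_compl bS') kT => T'; exact: tensor_sums_comp.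
Qed.

Lemma toeplitz_compact_diag (c : nat -> J -> R) (M : R) :
  (forall n j, `|c n j| <= M) ->
  (forall j, exists l : R, c n j @[n --> \oo] --> l) ->
  (forall e, 0 < e -> exists F : seq J, forall n j, j \notin F -> `|c n j| <= e) ->
  TK (diag_op (fun p => c p.1 p.2)).
Proof.
move=> cM cvg_c small_c.
have bc : bounded_weight (fun p : nat * J => c p.1 p.2) by exists M => -[n j] /=.
pose d (F : seq J) (p : nat * J) := if p.2 \in F then c p.1 p.2 else 0.
have bd F : bounded_weight (d F).
  exists M => -[n j]; rewrite /d /=; case: ifP => // _.
  by rewrite normr0; apply: le_trans (cM n j).
have dZ F : Z (diag_op (d F)).
  elim: F => [|j F IHF].
    have -> : diag_op (d [::]) = fun=> 0; last exact: tensor_sums0.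
    by apply/funext => x; apply: ell2_ext => p; rewrite diag_opE// mul0r.
  (* An index that already occurs in F must not be counted twice, hence the value 0. *)
  pose cj n := if j \in F then 0 else c n j.
  have bcj : bounded_weight cj.
    exists M => n; rewrite /cj; case: ifP => // _.
    by rewrite normr0; apply: le_trans (cM n j).
  have -> : diag_op (d (j :: F)) =
      fun x => optensor (diag_op cj) (unit_diag j) x + diag_op (d F) x.
    have bj := @bounded_weight_eq R _ j.
    rewrite optensor_diag//; apply/funext => x; apply: ell2_ext => -[n j'].
    rewrite ell2_coordD !diag_opE//; last exact: (bounded_weightM bcj bj).
    rewrite -mulrDl -rmorphD /= /d /cj /= in_cons; case: eqVneq => [->|_] /=.
      by rewrite mulr1; case: ifP; rewrite ?addr0 ?add0r.
    by rewrite mulr0 add0r.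
  apply: tensor_sumsD => //; apply: tensor_sums_tensor; last exact: compact_unit_diag.
  have [l cl] : exists l : R, cj n @[n --> \oo] --> l.
    by rewrite /cj; case: (j \in F); [exists 0; exact: cvg_cst|exact: cvg_c].
  exact: diag_toeplitz cl.
apply/opnorm_closureP; split; first exact: diag_op_bounded.
move=> e e0; have [F Fe] := small_c _ e0.
exists (diag_op (d F)); first exact: dZ.
have small p : `|c p.1 p.2 - d F p| <= e.
  rewrite /d; case: ifPn => [_|/Fe]; last by rewrite subr0.
  by rewrite subrr normr0 ltW.
have bB : bounded_weight (fun p => c p.1 p.2 - d F p) by exists e.
have -> : (fun x => diag_op (fun p => c p.1 p.2) x - diag_op (d F) x) =
    diag_op (fun p => c p.1 p.2 - d F p).
  apply/funext => x; apply: ell2_ext => p; rewrite ell2_coordB !diag_opE//.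
  by rewrite rmorphB mulrBl.
by apply: weighted_pull_bound => //; [exact: partial_inj_Some|exact: ltW].
Qed.

End ToeplitzCompact.

(** * Asymptotics of the coefficients *)

Section Coefficients.
Context {R : realType} (q : R) (q_gtN1 : -1 < q) (q_lt1 : q < 1).
Local Notation g := (qg q).
Local Notation w := (`|q|).

Lemma q_norm_lt1 : w < 1. Proof. by rewrite ltr_norml q_gtN1. Qed.
Lemma q_exp_le m n : (m <= n)%N -> w ^+ n <= w ^+ m.
Proof. by move=> mn; apply: ler_wiXn2l => //; exact: ltW q_norm_lt1. Qed.

(** q may be negative, but g involves only even powers, which depend on |q|; monotonicity in the
    exponent follows. *)
Lemma q_evenE n : q ^+ (2 * n) = w ^+ (2 * n).
Proof. by rewrite !exprM real_normK ?num_real. Qed.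

Lemma q_even_le1 n : q ^+ (2 * n) <= 1.
Proof. by rewrite q_evenE -(expr0 w) q_exp_le. Qed.

Lemma qg_ge0 n : 0 <= g n. Proof. exact: sqrtr_ge0. Qed.

Lemma qg_sqr n : g n ^+ 2 = 1 - q ^+ (2 * n).
Proof. by rewrite sqr_sqrtr// subr_ge0 q_even_le1. Qed.

Lemma qg0 : g 0 = 0. Proof. by rewrite /qg muln0 expr0 subrr sqrtr0. Qed.

Lemma qg_le1 n : g n <= 1.
Proof.
rewrite -(@ler_pXn2r _ 2)// ?nnegrE ?qg_ge0// qg_sqr expr1n gerBl q_evenE.
exact: exprn_ge0.
Qed.

Lemma qg_mono m n : (m <= n)%N -> g m <= g n.
Proof.
move=> mn; apply: ler_wsqrtr; rewrite lerD2l lerN2 !q_evenE q_exp_le//.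
by rewrite leq_mul2l.
Qed.

Lemma qg_gt0 n : (0 < n)%N -> 0 < g n.
Proof.
move=> n0; apply: lt_le_trans (qg_mono n0).
rewrite sqrtr_gt0 subr_gt0 q_evenE muln1.
by rewrite expr_lt1// q_norm_lt1.
Qed.

(** This is 1 / (1 - q^2). As g is nondecreasing, g 1 is its least value at positive arguments, so K
    bounds the inverse of every product of two such values. *)
Let K := (g 1 ^+ 2)^-1.

Lemma qg_K_ge0 : 0 <= K. Proof. by rewrite invr_ge0 sqr_ge0. Qed.

Lemma qg_prod_ge m a b : (m <= a)%N -> (m <= b)%N -> g m ^+ 2 <= g a * g b.
Proof. by move=> ma mb; rewrite expr2 ler_pM ?qg_ge0 ?qg_mono. Qed.

Lemma qg_prod_le1 a b : g a * g b <= 1.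
Proof. by rewrite -[1]mulr1 ler_pM ?qg_ge0 ?qg_le1. Qed.

Lemma qg_den_le c d : (0 < c)%N -> (0 < d)%N -> (g c * g d)^-1 <= K.
Proof.
move=> c0 d0; rewrite lef_pV2 ?qg_prod_ge// posrE; first by rewrite mulr_gt0 ?qg_gt0.
by rewrite exprn_gt0// qg_gt0.
Qed.

Lemma qg_ratio_le a b c d : (0 < c)%N -> (0 < d)%N ->
  `|g a * g b / (g c * g d)| <= K.
Proof.
move=> c0 d0; rewrite ger0_norm; last by rewrite divr_ge0 ?mulr_ge0 ?qg_ge0.
rewrite -[K]mul1r ler_pM ?mulr_ge0 ?invr_ge0 ?mulr_ge0 ?qg_ge0//.
  exact: qg_prod_le1.
exact: qg_den_le.
Qed.

(** Both x and the denominator lie in [1 - q^(2u), 1], so they differ by at most q^(2u). *)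
Lemma qg_ratio_near1 u x c d : (0 < u)%N -> (u <= c)%N -> (u <= d)%N ->
  g u ^+ 2 <= x -> x <= 1 -> `|x / (g c * g d) - 1| <= w ^+ (2 * u) * K.
Proof.
move=> u0 uc ud ux x1.
have c0 := leq_trans u0 uc; have d0 := leq_trans u0 ud.
have gcd0 : 0 < g c * g d by rewrite mulr_gt0 ?qg_gt0.
have -> : x / (g c * g d) - 1 = (x - g c * g d) / (g c * g d).
  by field; rewrite !gt_eqF ?qg_gt0.
rewrite normrM ler_pM//; last first.
  by rewrite gtr0_norm ?invr_gt0// qg_den_le.
have := qg_prod_ge uc ud; have := qg_prod_le1 c d.
rewrite -q_evenE; move: ux; rewrite qg_sqr => ? ? ?.
rewrite ler_norml; apply/andP; split; lra.
Qed.

Lemma cvg_qg (f : nat -> nat) : (forall n, (n <= f n)%N) ->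
  g (f n) @[n --> \oo] --> (1 : R).
Proof.
move=> nf; apply/cvgrPdist_lt => e e0.
have [N NP] := expr_eventually_lt q_norm_lt1 e0.
exists N => // n /= /NP; apply: le_lt_trans.
rewrite ger0_norm ?subr_ge0 ?qg_le1//.
(* Since 0 <= g <= 1, squaring g only increases the distance to 1 and leaves a plain power of q. *)
apply: (@le_trans _ _ (1 - g (f n) ^+ 2)).
  by rewrite lerD2l lerN2 expr2 ler_piMr ?qg_ge0 ?qg_le1.
rewrite qg_sqr opprB addrC subrK q_evenE q_exp_le//.
by apply: leq_trans (nf n) _; rewrite mul2n -addnn leq_addl.
Qed.

Lemma cvg_qg_prod (f h : nat -> nat) :
  (forall n, (n <= f n)%N) -> (forall n, (n <= h n)%N) ->
  g (f n) * g (h n) @[n --> \oo] --> (1 : R).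
Proof. by move=> nf nh; rewrite -[X in _ --> X]mulr1; apply: cvgM; exact: cvg_qg. Qed.

Lemma cvg_qg_ratio (x : nat -> R) (l : R) (c d : nat -> nat) :
  x n @[n --> \oo] --> l ->
  (forall n, (n <= c n)%N) -> (forall n, (n <= d n)%N) ->
  x n / (g (c n) * g (d n)) @[n --> \oo] --> l.
Proof.
move=> xl nc nd; rewrite -[X in _ --> X]divr1; apply: cvgM => //.
by apply: cvgV; [exact: oner_neq0|exact: cvg_qg_prod].
Qed.

(* The guards are redundant because g 0 = 0 and x / 0 = 0. *)
Lemma a_minusE m k l : a_minus q m k l = g l * g k / (g m * g (m + 1)).
Proof.
rewrite /a_minus; case: k l => [|k] [|l] //=; rewrite ?qg0 ?mulr0 ?mul0r//.
Qed.

Lemma b_minusE m k l : b_minus q m k l =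
  q ^+ k * (g l * g (m - k)) / (g m * g (m + 1)).
Proof.
rewrite /b_minus; case: ltnP => [km|mk] /=; last first.
  by move: (mk); rewrite -subn_eq0 => /eqP ->; rewrite qg0 !mulr0 mul0r.
by case: l => [|l] //=; rewrite qg0 mul0r mulr0 mul0r.
Qed.

End Coefficients.

(** With k = s + [tneg t] and l = s + [tpos t], the exponent max(k, l) - l of the sign in U is
    [tneg t]. [Negz n] stands for -(n + 1). *)
Definition tneg (t : int) : nat := if t is Negz n then n.+1 else 0.
Definition tpos (t : int) : nat := if t is Posz n then n else 0.

(* The basis vector e(r, (s, t)) is, up to sign, the image under U of the vector
   of Gamma encoded by (mG r (s, t), kG (s, t), lG (s, t)). *)
Definition kG (j : Hpi_index) : nat := j.1 + tneg j.2.
Definition lG (j : Hpi_index) : nat := j.1 + tpos j.2.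
Definition mG (r : nat) (j : Hpi_index) : nat := r + j.1 + (tpos j.2 + tneg j.2).
Definition decay_exponent (j : Hpi_index) : nat := j.1 + (tpos j.2 + tneg j.2).

Lemma kG_le r j : (kG j <= mG r j)%N.
Proof. by rewrite /kG /mG; lia. Qed.

Lemma lG_le r j : (lG j <= mG r j)%N.
Proof. by rewrite /lG /mG; lia. Qed.

Lemma tpos_tneg t : (tpos t == 0%N) || (tneg t == 0%N).
Proof. by case: t => n; rewrite /= ?eqxx ?orbT. Qed.

(** * Decay and convergence of the weights *)

Section Weights.
Context {R : realType} (q : R) (q_gtN1 : -1 < q) (q_lt1 : q < 1).
Local Notation g := (qg q).
Local Notation w := (`|q|).
Local Notation TK := (spatial_tensor (@toeplitz R) (@compact_op R Hpi_index)).
Local Notation K := ((g 1 ^+ 2)^-1).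

(** Boundedness is recorded because the coordinate formula [diag_opE] depends on it. *)
Definition toeplitz_compact_weight (c : nat -> Hpi_index -> R) :=
  bounded_weight (fun p : nat * Hpi_index => c p.1 p.2) /\
  TK (diag_op (fun p => c p.1 p.2)).

Lemma toeplitz_compact_weight_decay (c : nat -> Hpi_index -> R) :
  (forall r j, `|c r j| <= w ^+ decay_exponent j * K) ->
  (forall j, exists l : R, c r j @[r --> \oo] --> l) ->
  toeplitz_compact_weight c.
Proof.
have w1 := q_norm_lt1 q_gtN1 q_lt1; have K0 : 0 <= K := qg_K_ge0 q.
move=> cK cvg_c.
have cK' r j : `|c r j| <= K.
  apply: le_trans (cK r j) _; rewrite ler_piMl//.
  by rewrite -(expr0 w) q_exp_le.
split; first by exists K => -[r j]; exact: cK'.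
apply: (toeplitz_compact_diag (M := K)) => // e e0.
have K1 : 0 < K + 1 by rewrite ltr_wpDl.
have [N NP] := expr_eventually_lt w1 (divr_gt0 e0 K1).
(* The list contains every (s, t) with s + |t| < N. *)
exists [seq (s, t) : Hpi_index | s <- iota 0 N,
  t <- [seq Posz n | n <- iota 0 N] ++ [seq Negz n | n <- iota 0 N]] => r [s t] stF.
have Nst : (N <= decay_exponent (s, t))%N.
  rewrite leqNgt; apply: contra stF => ltN; apply/allpairsP; exists (s, t) => /=.
  move: ltN; rewrite /decay_exponent /= => ltN; split=> //.
    by rewrite mem_iota /=; lia.
  rewrite mem_cat; apply/orP; case: t ltN => n /= ltN; [left|right]; apply: map_f;
    by rewrite mem_iota /=; lia.
apply: le_trans (cK _ _) _; apply: (@le_trans _ _ (e / (K + 1) * (K + 1))).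
  by apply: ler_pM; rewrite ?exprn_ge0 ?lerDl ?(ltW (NP _ Nst)).
by rewrite divfK// gt_eqF.
Qed.

(* The weights of D alpha and D beta on the basis e(r, j). The minus signs come
   from the factor (-1)^(max(i, j) - j) of U, whose exponent changes only where
   j.2 = l - k <= 0; there b_plus becomes the term compared with pi beta. *)
Definition weight_a1 r j : R := a_plus q (mG r j) (kG j) (lG j).
Definition weight_a2 r j : R := a_minus q (mG r j) (kG j) (lG j) - g j.1.
Definition weight_b1 r j : R :=
  if (0 < tpos j.2)%N then b_plus q (mG r j) (kG j) (lG j) else 0.
Definition weight_b2 r j : R :=
  (if (0 < tpos j.2)%N then b_minus q (mG r j) (kG j) (lG j)
   else - b_plus q (mG r j) (kG j) (lG j)) - q ^+ j.1.
Definition weight_b3 r j : R :=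
  if (0 < tpos j.2)%N then 0 else - b_minus q (mG r j) (kG j) (lG j).

Lemma bound_term (x y : R) e d : (d <= e)%N -> `|x| <= w ^+ e -> `|y| <= K ->
  `|x * y| <= w ^+ d * K.
Proof.
move=> de xe yK; rewrite normrM ler_pM//; apply: le_trans xe _.
exact: q_exp_le.
Qed.

Lemma weight_a1_toeplitz_compact : toeplitz_compact_weight weight_a1.
Proof.
apply: toeplitz_compact_weight_decay => [r j|j]; rewrite /weight_a1 /a_plus.
  rewrite -mulrA; apply: (bound_term (e := kG j + lG j + 1)).
  - by rewrite /decay_exponent /kG /lG; lia.
  - by rewrite normrX.
  - by apply: qg_ratio_le => //; rewrite addn_gt0 orbT.
eexists; apply: cvg_qg_ratio => //; last first.
- by move=> r; rewrite /mG; lia.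
- by move=> r; rewrite /mG; lia.
apply: cvgM; first exact: cvg_cst.
by apply: cvg_qg_prod => // r; rewrite /mG /kG /lG; lia.
Qed.

Lemma weight_a2_toeplitz_compact : toeplitz_compact_weight weight_a2.
Proof.
apply: toeplitz_compact_weight_decay => [r j|j]; rewrite /weight_a2.
  (* One of k and l is s and the other is s + |t|. *)
  rewrite a_minusE; have -> : g (lG j) * g (kG j) = g j.1 * g (decay_exponent j).
    have := tpos_tneg j.2; rewrite /lG /kG /decay_exponent.
    by case/orP => /eqP ->; rewrite ?addn0 ?add0n // mulrC.
  (* For s = 0 both terms vanish with g 0. Otherwise the factor g s comes out, and [qg_ratio_near1]
     applies with u = s + |t| > 0. *)
  case: j => [[|s] t] /=; rewrite /=.
    by rewrite qg0 !mul0r subrr normr0 mulr_ge0 ?exprn_ge0 ?qg_K_ge0.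
  set x := g (decay_exponent _).
  rewrite -mulrA -[X in _ - X]mulr1 -mulrBr normrM -[leRHS]mul1r.
  apply: ler_pM => //; first by rewrite ger0_norm ?qg_ge0 ?qg_le1.
  apply: (@le_trans _ _ (w ^+ (2 * decay_exponent (s.+1, t)) * K)).
    apply: qg_ratio_near1 => //.
    - by rewrite /mG /decay_exponent /=; lia.
    - by rewrite /mG /decay_exponent /=; lia.
    - by rewrite expr2 ler_piMl ?qg_ge0 ?qg_le1.
    - exact: qg_le1.
  by rewrite ler_wpM2r ?qg_K_ge0// q_exp_le// leq_pmull.
eexists; apply: cvgB; last exact: cvg_cst.
under eq_fun do rewrite a_minusE.
apply: cvg_qg_ratio => //; first exact: cvg_cst.
- by move=> r; rewrite /mG; lia.
- by move=> r; rewrite /mG; lia.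
Qed.

Lemma weight_b1_toeplitz_compact : toeplitz_compact_weight weight_b1.
Proof.
apply: toeplitz_compact_weight_decay => [r j|j]; rewrite /weight_b1;
  case: (boolP (0 < tpos j.2)%N) => t0.
(* For t > 0 the exponent l of q is exactly s + |t|. *)
- rewrite /b_plus -mulrA; apply: (bound_term (e := lG j)).
  + move: (tpos_tneg j.2); rewrite /decay_exponent /lG; lia.
  + by rewrite normrN normrX.
  + by apply: qg_ratio_le => //; rewrite addn_gt0 orbT.
- by rewrite normr0 mulr_ge0 ?exprn_ge0 ?qg_K_ge0.
- eexists; apply: cvg_qg_ratio => //; last first.
  + by move=> r; rewrite /mG; lia.
  + by move=> r; rewrite /mG; lia.
  apply: cvgM; first exact: cvg_cst.
  apply: cvgM; last exact: cvg_cst.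
  by apply: cvg_qg => // r; rewrite /mG /lG; lia.
- by exists 0; exact: cvg_cst.
Qed.

Lemma weight_b2_toeplitz_compact : toeplitz_compact_weight weight_b2.
Proof.
apply: toeplitz_compact_weight_decay => [r j|j]; rewrite /weight_b2;
  case: (boolP (0 < tpos j.2)%N) => t0.
- have tn0 : tneg j.2 = 0%N by move: (tpos_tneg j.2); lia.
  (* Here k = s, so q^s comes out. The arguments l and m - k of g are at least t > 0, which leaves a
     cancellation of order q^(2t). *)
  rewrite b_minusE /kG tn0 addn0 -mulrA -[X in _ - X]mulr1 -mulrBr normrM normrX.
  rewrite /decay_exponent tn0 addn0 exprD -[leRHS]mulrA ler_wpM2l ?exprn_ge0//.
  apply: (@le_trans _ _ (w ^+ (2 * tpos j.2) * K)).
    apply: qg_ratio_near1 => //.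
    + by rewrite /mG; lia.
    + by rewrite /mG; lia.
    + by apply: qg_prod_ge => //; rewrite /lG /mG; lia.
    + exact: qg_prod_le1.
  by rewrite ler_wpM2r ?qg_K_ge0// q_exp_le// leq_pmull.
- have tp0 : tpos j.2 = 0%N by lia.
  (* Here l = s, and the arguments k + 1 and m - l + 1 of g are at least |t| + 1; the extra 1 keeps
     [qg_ratio_near1] applicable at t = 0. *)
  rewrite /b_plus /lG tp0 addn0 !mulNr opprK -mulrA -[X in _ - X]mulr1 -mulrBr normrM normrX.
  rewrite /decay_exponent tp0 add0n exprD -[leRHS]mulrA ler_wpM2l ?exprn_ge0//.
  apply: (@le_trans _ _ (w ^+ (2 * (tneg j.2).+1) * K)).
    apply: qg_ratio_near1 => //.
    + by rewrite /mG; lia.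
    + by rewrite /mG; lia.
    + by apply: qg_prod_ge => //; rewrite /kG /mG; lia.
    + exact: qg_prod_le1.
  by rewrite ler_wpM2r ?qg_K_ge0// q_exp_le// mulnS mul2n -addnn addnA leq_addl.
- have tn0 : tneg j.2 = 0%N by move: (tpos_tneg j.2); lia.
  eexists; apply: cvgB; last exact: cvg_cst.
  under eq_fun do rewrite b_minusE.
  apply: cvg_qg_ratio => //; last first.
  + by move=> r; rewrite /mG; lia.
  + by move=> r; rewrite /mG; lia.
  apply: cvgM; first exact: cvg_cst.
  apply: cvgM; first exact: cvg_cst.
  by apply: cvg_qg => // r; rewrite /mG /kG; lia.
- eexists; apply: cvgB; last exact: cvg_cst.
  apply: cvgN; apply: cvg_qg_ratio => //; last first.
  + by move=> r; rewrite /mG; lia.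
  + by move=> r; rewrite /mG; lia.
  apply: cvgM; first exact: cvg_cst.
  apply: cvgM; last exact: cvg_cst.
  by apply: cvg_qg => // r; rewrite /mG /lG; lia.
Qed.

Lemma weight_b3_toeplitz_compact : toeplitz_compact_weight weight_b3.
Proof.
apply: toeplitz_compact_weight_decay => [r j|j]; rewrite /weight_b3;
  case: (boolP (0 < tpos j.2)%N) => t0.
- by rewrite normr0 mulr_ge0 ?exprn_ge0 ?qg_K_ge0.
(* At m = 0 the denominator is 0 and its inverse defaults to 0. Otherwise t <= 0 makes the exponent
   k equal to s + |t|. *)
- rewrite normrN b_minusE; have [m0|m0] := posnP (mG r j).
    rewrite m0 qg0 mul0r invr0 mulr0 normr0.
    by rewrite mulr_ge0 ?exprn_ge0 ?qg_K_ge0.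
  rewrite -mulrA; apply: (bound_term (e := kG j)).
  + by move: (tpos_tneg j.2); rewrite /decay_exponent /kG; lia.
  + by rewrite normrX.
  + by apply: qg_ratio_le => //; rewrite addn_gt0 orbT.
- by exists 0; exact: cvg_cst.
- eexists; apply: cvgN.
  under eq_fun do rewrite b_minusE.
  apply: cvg_qg_ratio => //; last first.
  + by move=> r; rewrite /mG; lia.
  + by move=> r; rewrite /mG; lia.
  apply: cvgM; first exact: cvg_cst.
  apply: cvgM; first exact: cvg_cst.
  by apply: cvg_qg => // r; rewrite /mG /kG; lia.
Qed.

End Weights.

(** * The generators of C(SU_q(2)) *)

Section Generators.
Context {R : realType}.
Local Notation C := R[i].
Local Notation op := (ell2 R (nat * Hpi_index)%type -> ell2 R (nat * Hpi_index)%type).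
Local Notation TK := (spatial_tensor (@toeplitz R) (@compact_op R Hpi_index)).

(** Pullbacks move basis vectors by the inverse map: [pull (hup d)] lowers s by 1 and kills s = 0,
    [pull (hdown d)] raises s by 1, [pull (hsame d)] keeps s, and all three send t to t - d. *)
Definition hup (d : int) (j : Hpi_index) : option Hpi_index := Some (j.1.+1, j.2 + d).
Definition hdown (d : int) (j : Hpi_index) : option Hpi_index :=
  if j.1 is s.+1 then Some (s, j.2 + d) else None.
Definition hsame (d : int) (j : Hpi_index) : option Hpi_index := Some (j.1, j.2 + d).

Lemma hup_hdown d e : e = - d ->
  forall k l, (hup e l == Some k) = (hdown d k == Some l).
Proof.
move=> -> [s t] [s' t']; rewrite /hup /hdown /=; case: s => [|s].
  by apply/eqP => -[].
rewrite !(inj_eq Some_inj) !xpair_eqE eqSS eq_sym; congr andb.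
by rewrite subr_eq eq_sym.
Qed.

Lemma hdown_hup d e : e = - d ->
  forall k l, (hdown e l == Some k) = (hup d k == Some l).
Proof. by move=> -> k l; rewrite (@hup_hdown (- d) d) ?opprK. Qed.

Lemma hsame_hsame d e : e = - d ->
  forall k l, (hsame e l == Some k) = (hsame d k == Some l).
Proof.
move=> -> [s t] [s' t']; rewrite /hsame /= !(inj_eq Some_inj) !xpair_eqE eq_sym.
by congr andb; rewrite subr_eq eq_sym.
Qed.

(* Carrying the adjoint along makes the final induction on C(SU_q(2)) closed
   under star without knowing that adjoints of compact operators exist and
   are compact. *)
Definition toeplitz_compact_with_adjoint (T : op) :=
  exists T', [/\ is_adjoint T T', TK T & TK T'].

Lemma toeplitz_compact_with_adjointD S T :
  toeplitz_compact_with_adjoint S -> toeplitz_compact_with_adjoint T ->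
  toeplitz_compact_with_adjoint (fun x => S x + T x).
Proof.
move=> [S' [SS' kS kS']] [T' [TT' kT kT']]; exists (fun x => S' x + T' x).
by split; [exact: is_adjointD|exact: toeplitz_compactD|exact: toeplitz_compactD].
Qed.

(** The weights are real, so the diagonal factor is its own adjoint and only changes sides. *)
Lemma toeplitz_compact_with_adjoint_mul P P' Q Q' (c : nat -> Hpi_index -> R) :
  toeplitz P -> toeplitz P' -> is_adjoint P P' ->
  bounded_op Q -> bounded_op Q' -> is_adjoint Q Q' -> toeplitz_compact_weight c ->
  toeplitz_compact_with_adjoint (optensor P Q \o diag_op (fun p => c p.1 p.2)).
Proof.
move=> tP tP' PP' bQ bQ' QQ' [bc kc].
exists (diag_op (fun p => c p.1 p.2) \o optensor P' Q'); split.
- apply: is_adjoint_comp; last exact: diag_op_adjoint.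
  by apply: optensor_adjoint => //; exact: toeplitz_bounded.
- exact: toeplitz_compact_compl.
- exact: toeplitz_compact_compr.
Qed.

Lemma optensor_diag_bounded P Q (c : nat -> Hpi_index -> R) :
  bounded_op P -> bounded_op Q -> toeplitz_compact_weight c ->
  bounded_op (optensor P Q \o diag_op (fun p => c p.1 p.2)).
Proof.
move=> bP bQ [bc _]; apply: bounded_op_comp; first exact: optensor_bounded.
exact: diag_op_bounded.
Qed.

Lemma optensor_diag_basis P Q (c : nat -> Hpi_index -> R) r j :
  bounded_op P -> bounded_op Q -> toeplitz_compact_weight c ->
  (optensor P Q \o diag_op (fun p => c p.1 p.2)) (ell2_basis (r, j)) =
  (c r j)%:C%C *: tensor_vec (P (ell2_basis r)) (Q (ell2_basis j)).
Proof.
move=> bP bQ [bc _]; rewrite /= diag_op_basis// (linZ (bounded_op_linear _)).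
  by rewrite optensor_basis.
exact: optensor_bounded.
Qed.

Section Unitary.
Variables (U : ell2 R Gamma -> ell2 R (nat * Hpi_index)%type)
  (Ust : ell2 R (nat * Hpi_index)%type -> ell2 R Gamma) (UP : is_U U Ust).

Lemma is_adjoint_Ust : is_adjoint Ust U.
Proof. by case: UP => -[_ _ UU _ _] _; exact: is_adjoint_sym. Qed.

Lemma U_eGamma r j : U (eGamma (mG r j) (kG j) (lG j)) =
  (-1) ^+ tneg j.2 *: ell2_basis (r, j).
Proof.
case: UP => _ ->; rewrite /mG /kG /lG; try lia.
case: j => s [n|n] /=; congr (_ ^+ _ *: ell2_basis _).
- by lia.
- by congr (_, (_, _)); lia.
- by lia.
- by congr (_, (_, _)); lia.
Qed.

Lemma U_eGamma_eq m k l r j : m = mG r j -> k = kG j -> l = lG j ->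
  U (eGamma m k l) = (-1) ^+ tneg j.2 *: ell2_basis (r, j).
Proof. by move=> -> -> ->; exact: U_eGamma. Qed.

Lemma Ust_basis r j : Ust (ell2_basis (r, j)) =
  (-1) ^+ tneg j.2 *: eGamma (mG r j) (kG j) (lG j).
Proof.
case: (UP) => -[_ bUst _ UK _] _.
rewrite -[RHS]UK (linZ (bounded_op_linear _)); last by case: UP => -[].
by rewrite U_eGamma scalerA -expr2 sqrr_sign scale1r.
Qed.

Section Lambda.
Variables (T : ell2 R Gamma -> ell2 R Gamma) (bT : bounded_op T).

Lemma U_conj_basis r j : U (T (Ust (ell2_basis (r, j)))) =
  (-1) ^+ tneg j.2 *: U (T (eGamma (mG r j) (kG j) (lG j))).
Proof.
have lU : linear U by case: UP => -[[]].
by rewrite Ust_basis (linZ (bounded_op_linear bT)) (linZ lU).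
Qed.

End Lambda.
End Unitary.

End Generators.

(** * The difference D(a): values at the generators and algebraic rules *)

Section Difference.
Context {R : realType} (q : R) (q_gtN1 : -1 < q) (q_lt1 : q < 1).
Local Notation C := R[i].
Local Notation op := (ell2 R (nat * Hpi_index)%type -> ell2 R (nat * Hpi_index)%type).
Local Notation TK := (spatial_tensor (@toeplitz R) (@compact_op R Hpi_index)).
Variables (A : cstarAlgType R) (alpha beta : A).
Variables (lambda : A -> ell2 R Gamma -> ell2 R Gamma)
  (lambdaP : is_lambda q alpha beta lambda).
Variables (pi : A -> ell2 R Hpi_index -> ell2 R Hpi_index)
  (piP : is_pi q alpha beta pi).
Variables (U : ell2 R Gamma -> ell2 R (nat * Hpi_index)%type)
  (Ust : ell2 R (nat * Hpi_index)%type -> ell2 R Gamma) (UP : is_U U Ust).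

Definition difference (a : A) : op :=
  fun x => U (lambda a (Ust x)) - optensor id (pi a) x.
Local Notation D := difference.

Let bU : bounded_op U. Proof. by case: UP => -[]. Qed.
Let bUst : bounded_op Ust. Proof. by case: UP => -[]. Qed.
Let lU : linear U. Proof. exact: bounded_op_linear. Qed.
Let bl a : bounded_op (lambda a). Proof. by case: lambdaP => -[]. Qed.
Let bp a : bounded_op (pi a). Proof. by case: piP => -[]. Qed.
Let bid := @bounded_op_id R nat.

Lemma difference_bounded a : bounded_op (D a).
Proof.
apply: bounded_opB; last exact: optensor_bounded.
apply: (bounded_op_comp bU); exact: bounded_op_comp.
Qed.

Lemma difference_adjoint a : is_adjoint (D a) (D (star a)).
Proof.
case: lambdaP piP => -[_ _ _ _ ladj] _ _ [[_ _ _ _ padj] _ _].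
apply: is_adjointB; last exact: optensor_adjoint.
have UU : is_adjoint U Ust by case: UP => -[].
by move=> x y; rewrite UU ladj (is_adjoint_Ust UP).
Qed.

Lemma difference_basis a r j : D a (ell2_basis (r, j)) =
  (-1) ^+ tneg j.2 *: U (lambda a (eGamma (mG r j) (kG j) (lG j))) -
  tensor_vec (ell2_basis r) (pi a (ell2_basis j)).
Proof. by rewrite /D (U_conj_basis UP)// optensor_basis. Qed.

Lemma sign_scaleK n c (x : ell2 R (nat * Hpi_index)%type) :
  (-1) ^+ n *: (c *: ((-1) ^+ n *: x)) = c *: x.
Proof. by rewrite !scalerA mulrAC -expr2 sqrr_sign mul1r. Qed.

Lemma sign_scaleNK n c (x : ell2 R (nat * Hpi_index)%type) :
  (-1) ^+ n *: (c *: ((-1) ^+ n.+1 *: x)) = - (c *: x).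
Proof. by rewrite exprS -scalerA scaleN1r !scalerN sign_scaleK. Qed.

Lemma tensor_vec0 (u : ell2 R nat) : tensor_vec u (0 : ell2 R Hpi_index) = 0.
Proof. by rewrite -[X in tensor_vec _ X](scale0r 0) tensor_vecZr scale0r. Qed.

Lemma shift_basis r : shift_op (ell2_basis r) = ell2_basis r.+1 :> ell2 R nat.
Proof. by rewrite /shift_op (pull_basis pred_succ_opt). Qed.

(** The [a_plus] term raises m and fixes k and l: r goes up and (s, t) stays. The [a_minus] term
    lowers m, k and l together: only s goes down, as under 1 (x) pi(alpha), whose weight is
    subtracted there. *)
Definition difference_alpha : op := fun x =>
  (optensor shift_op id \o diag_op (fun p => weight_a1 q p.1 p.2)) x +
  (optensor id (pull (hup 0)) \o diag_op (fun p => weight_a2 q p.1 p.2)) x.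

Lemma difference_alphaE : D alpha = difference_alpha.
Proof.
have w1 := weight_a1_toeplitz_compact q_gtN1 q_lt1.
have w2 := weight_a2_toeplitz_compact q_gtN1 q_lt1.
have bh := @pull_bounded R _ _ _ _ (@hup_hdown 0 0 erefl).
have bS := @shift_bounded R.
have bJ := @bounded_op_id R Hpi_index.
apply: bounded_op_eq => [||[r j]]; first exact: difference_bounded.
  by apply: bounded_opD; exact: optensor_diag_bounded.
rewrite /difference_alpha !optensor_diag_basis//.
rewrite difference_basis shift_basis (pull_basis (@hup_hdown 0 0 _)) ?oppr0//.
have [_ lamE _] := lambdaP; rewrite (lamE _ _ _ (kG_le r j) (lG_le r j)).
rewrite (linD lU) !(linZ lU) scalerDr.
rewrite -[(mG r j).+1]/(mG r.+1 j) (U_eGamma UP) sign_scaleK.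
rewrite -addrA tensor_vec_basis; congr (_ + _).
case: piP => _ piA _.
(* For s = 0, pi(alpha) kills the vector and the guard of [a_minus] fails because k or l is 0. *)
case: j => -[|s] t; rewrite piA /hdown /=.
  rewrite tensor_vec0 subr0 scaler0 /a_minus /kG /lG /=.
  by case: t => n /=; rewrite ?andbF scale0r scaler0.
have -> : (mG r (s.+1, t)).-1 = mG r (s, t) by rewrite /mG /=; lia.
rewrite -[(s + tneg t)%N]/(kG (s, t)) -[(s + tpos t)%N]/(lG (s, t)).
rewrite (U_eGamma UP) sign_scaleK.
by rewrite addr0 tensor_vecZr !tensor_vec_basis -scalerBl -rmorphB.
Qed.

(** Every term sends t to t - 1. For t > 0, [b_plus] raises both r and s, and [b_minus] keeps them.
    For t <= 0, [b_plus] keeps them, and [b_minus] lowers both. The middle summand collects the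
    terms that keep r and s, as 1 (x) pi(beta) does. *)
Definition difference_beta : op := fun x =>
  (optensor shift_op (pull (hdown 1)) \o diag_op (fun p => weight_b1 q p.1 p.2)) x +
  ((optensor id (pull (hsame 1)) \o diag_op (fun p => weight_b2 q p.1 p.2)) x +
   (optensor coshift_op (pull (hup 1)) \o diag_op (fun p => weight_b3 q p.1 p.2)) x).

Lemma difference_betaE : D beta = difference_beta.
Proof.
have w1 := weight_b1_toeplitz_compact q_gtN1 q_lt1.
have w2 := weight_b2_toeplitz_compact q_gtN1 q_lt1.
have w3 := weight_b3_toeplitz_compact q_gtN1 q_lt1.
have b1 := @pull_bounded R _ _ _ _ (@hdown_hup (-1) 1 erefl).
have b2 := @pull_bounded R _ _ _ _ (@hsame_hsame (-1) 1 erefl).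
have b3 := @pull_bounded R _ _ _ _ (@hup_hdown (-1) 1 erefl).
have bS := @shift_bounded R; have bS' := @coshift_bounded R.
apply: bounded_op_eq => [||[r j]]; first exact: difference_bounded.
  apply: bounded_opD; first exact: optensor_diag_bounded bS b1 w1.
  apply: bounded_opD; first exact: optensor_diag_bounded bid b2 w2.
  exact: optensor_diag_bounded bS' b3 w3.
rewrite /difference_beta (optensor_diag_basis _ _ bS b1 w1).
rewrite (optensor_diag_basis _ _ bid b2 w2) (optensor_diag_basis _ _ bS' b3 w3).
rewrite difference_basis shift_basis (pull_basis (@hdown_hup (-1) 1 erefl)).
rewrite (pull_basis (@hsame_hsame (-1) 1 erefl)) (pull_basis (@hup_hdown (-1) 1 erefl)).
rewrite /coshift_op (pull_basis succ_pred_opt) [oapp _ _ (hup _ _)]/= [oapp _ _ (hsame _ _)]/=.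
have [_ _ lamE] := lambdaP; rewrite (lamE _ _ _ (kG_le r j) (lG_le r j)).
have -> : pi beta (ell2_basis j) = (q ^+ j.1)%:C%C *: ell2_basis (j.1, j.2 - 1).
  by have [_ _ piE] := piP; case: j => s t; exact: piE.
rewrite (linD lU) !(linZ lU) scalerDr.
rewrite /weight_b1 /weight_b2 /weight_b3.
rewrite tensor_vecZr !tensor_vec_basis.
case: j => s t; rewrite [(s, t).1]/= [(s, t).2]/=.
set k := kG _; set l := lG _; set m := mG _ _.
case: (boolP (0 < tpos t)%N) => t0.
  have [tn tn' tp] : [/\ tneg t = 0, tneg (t - 1) = 0 & tpos t = (tpos (t - 1)).+1]%N.
    case: t t0 {k l m} => -[|n] //= _.
    by split; rewrite ?subn1.
  rewrite (U_eGamma_eq UP (r := r.+1) (j := (s.+1, t - 1))) /m /k /l /mG /kG /lG /=; try lia.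
  rewrite (U_eGamma_eq UP (r := r) (j := (s, t - 1))) /mG /kG /lG /=; try lia.
  rewrite tn tn' !expr0 !scale1r scale0r addr0 -addrA -scalerBl -rmorphB.
  by [].
have [tp tp' tn] : [/\ tpos t = 0, tpos (t - 1) = 0 & tneg (t - 1) = (tneg t).+1]%N.
  case: t t0 {k l m} => [[|n]|n] //= _.
  by split; rewrite ?addn0.
rewrite (U_eGamma_eq UP (r := r) (j := (s, t - 1))) /m /k /l; try by rewrite /mG /kG /lG /=; lia.
rewrite /= tn sign_scaleNK scale0r add0r.
(* The [b_minus] term would move to r - 1 and s - 1. For s = 0 one has l = 0, and for r = 0 one has
   k = m; in both cases its guard fails. *)
clear k l m; case: s => [|s].
  have -> : b_minus q (mG r (0%N, t)) (kG (0%N, t)) (lG (0%N, t)) = 0.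
    by rewrite /b_minus /lG /= tp andbF.
  rewrite scale0r scaler0 addr0 oppr0 scale0r addr0.
  by rewrite rmorphB scalerBl rmorphN scaleNr.
case: r => [|r].
  have -> : b_minus q (mG 0 (s.+1, t)) (kG (s.+1, t)) (lG (s.+1, t)) = 0.
    by rewrite /b_minus /mG /kG /= tp !add0n ltnn.
  rewrite scale0r scaler0 addr0 oppr0 scale0r addr0.
  by rewrite rmorphB scalerBl rmorphN scaleNr.
rewrite (U_eGamma_eq UP (r := r) (j := (s, t - 1))); try by rewrite /mG /kG /lG /=; lia.
rewrite /= tn sign_scaleNK tensor_vec_basis.
rewrite rmorphN scaleNr rmorphB scalerBl rmorphN scaleNr.
by rewrite addrAC.
Qed.

(** Adjoints are unique, so the adjoint found by hand for the explicit formula is [D (star a)]. *)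
Lemma toeplitz_compact_difference_adjoint a :
  toeplitz_compact_with_adjoint (D a) -> TK (D a) /\ TK (D (star a)).
Proof.
by move=> [T' [aT' ka kT']]; rewrite (is_adjoint_uniq (difference_adjoint a) aT').
Qed.

Lemma toeplitz_compact_difference_alpha : TK (D alpha) /\ TK (D (star alpha)).
Proof.
apply: toeplitz_compact_difference_adjoint; rewrite difference_alphaE.
have e0 : (0 : int) = - 0 by rewrite oppr0.
apply: toeplitz_compact_with_adjointD.
  apply: (@toeplitz_compact_with_adjoint_mul _ _ coshift_op _ id).
  - exact: shift_toeplitz.
  - exact: coshift_toeplitz.
  - exact: shift_adjoint.
  - exact: bounded_op_id.
  - exact: bounded_op_id.
  - by [].
  - exact: weight_a1_toeplitz_compact.
apply: (@toeplitz_compact_with_adjoint_mul _ _ id _ (pull (hdown 0))).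
- exact: id_toeplitz.
- exact: id_toeplitz.
- by [].
- exact: pull_bounded (hup_hdown e0).
- exact: pull_bounded (hdown_hup e0).
- exact: pull_adjoint (hup_hdown e0).
- exact: weight_a2_toeplitz_compact.
Qed.

Lemma toeplitz_compact_difference_beta : TK (D beta) /\ TK (D (star beta)).
Proof.
apply: toeplitz_compact_difference_adjoint; rewrite difference_betaE.
apply: toeplitz_compact_with_adjointD; last apply: toeplitz_compact_with_adjointD.
- apply: (@toeplitz_compact_with_adjoint_mul _ _ coshift_op _ (pull (hup (-1)))).
  + exact: shift_toeplitz.
  + exact: coshift_toeplitz.
  + exact: shift_adjoint.
  + exact: pull_bounded (@hdown_hup (-1) 1 erefl).
  + exact: pull_bounded (@hup_hdown 1 (-1) erefl).
  + exact: pull_adjoint (@hdown_hup (-1) 1 erefl).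
  + exact: weight_b1_toeplitz_compact.
- apply: (@toeplitz_compact_with_adjoint_mul _ _ id _ (pull (hsame (-1)))).
  + exact: id_toeplitz.
  + exact: id_toeplitz.
  + by [].
  + exact: pull_bounded (@hsame_hsame (-1) 1 erefl).
  + exact: pull_bounded (@hsame_hsame 1 (-1) erefl).
  + exact: pull_adjoint (@hsame_hsame (-1) 1 erefl).
  + exact: weight_b2_toeplitz_compact.
- apply: (@toeplitz_compact_with_adjoint_mul _ _ shift_op _ (pull (hdown (-1)))).
  + exact: coshift_toeplitz.
  + exact: shift_toeplitz.
  + exact: is_adjoint_sym shift_adjoint.
  + exact: pull_bounded (@hup_hdown (-1) 1 erefl).
  + exact: pull_bounded (@hdown_hup 1 (-1) erefl).
  + exact: pull_adjoint (@hup_hdown (-1) 1 erefl).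
  + exact: weight_b3_toeplitz_compact.
Qed.

Lemma difference_lincomb c x y u : D (c *: x + y) u = c *: D x u + D y u.
Proof.
have [[_ llin _ _ _] _ _] := lambdaP; have [[_ plin _ _ _] _ _] := piP.
rewrite /D llin lU.
have -> : pi (c *: x + y) = (fun u => c *: pi x u + pi y u).
  by apply/funext => v; exact: plin.
by rewrite optensor_lincombr// scalerBr opprD addrACA.
Qed.

Lemma differenceB x y u : D (x - y) u = D x u - D y u.
Proof.
have -> : x - y = (-1) *: y + x by rewrite scaleN1r addrC.
by rewrite difference_lincomb scaleN1r addrC.
Qed.

Lemma difference1 : D 1 = fun=> 0.
Proof.
have [[_ _ _ l1 _] _ _] := lambdaP; have [[_ _ _ p1 _] _ _] := piP.
have [[_ _ _ _ UstK] _] := UP.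
have bJ := @bounded_op_id R Hpi_index.
apply/funext => u; rewrite /D l1 UstK.
have -> : pi 1 = id by apply/funext => v; exact: p1.
rewrite (@optensor_eq _ _ _ _ _ id)// ?subrr//; first exact: bounded_op_id.
by move=> i j; rewrite tensor_vec_basis.
Qed.

Lemma differenceM x y : D (x * y) = fun u =>
  (D x \o D y) u + ((optensor id (pi x) \o D y) u + (D x \o optensor id (pi y)) u).
Proof.
have [[_ _ lM _ _] _ _] := lambdaP; have [[_ _ pM _ _] _ _] := piP.
have [[_ _ _ UK _] _] := UP.
have lD := bounded_op_linear (difference_bounded x).
have lP := bounded_op_linear (optensor_bounded bid (bp x)).
apply/funext => u.
have -> : D (x * y) u = U (lambda x (lambda y (Ust u))) -
    optensor id (pi x) (optensor id (pi y) u).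
  rewrite /D lM; congr (_ - _).
  have -> : pi (x * y) = pi x \o pi y by apply/funext => v; exact: pM.
  by rewrite -[id in LHS]/(id \o id) -optensor_comp.
rewrite /= {2 3}/D (linB lP) (linB lD) {1 2}/D UK.
set a := U _; set b := optensor _ _ (U _); set c := optensor _ _ (optensor _ _ u).
set d := U (lambda x _).
rewrite [D x _]/D -/c -/d.
by rewrite [b - c + _]addrC addrA subrK addrA subrK.
Qed.

End Difference.

(** * The involution is isometric *)

Section StarNorm.
Context {R : realType} {A : cstarAlgType R}.

Lemma star1 : star (1 : A) = 1.
Proof.
have := starM (star (1 : A)) 1; rewrite mulr1 !starK mulr1.
by move=> <-.
Qed.

Lemma star_lincomb (c : R[i]) (x y : A) :
  star (c *: x + y) = (c^*)%C *: star x + star y.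
Proof. by rewrite starD starZ. Qed.

Lemma starB (x y : A) : star (x - y) = star x - star y.
Proof. by rewrite -scaleN1r starD starZ rmorphN rmorph1 scaleN1r. Qed.

(** The C*-identity gives |x|^2 = |x^* x| <= |x^*| |x|. Isometry of the involution lets
    approximations of x serve for [star x]. *)
Lemma le_cnorm_star (x : A) : cnorm x <= cnorm (star x).
Proof.
have [x0|x0] := eqVneq (cnorm x) 0; first by rewrite x0 cnorm_ge0.
have xgt0 : 0 < cnorm x by rewrite lt_def x0 cnorm_ge0.
by rewrite -(ler_pM2r xgt0) -expr2 -cnorm_star cnormM.
Qed.

Lemma cnorm_starE (x : A) : cnorm (star x) = cnorm x.
Proof.
by apply/eqP; rewrite eq_le le_cnorm_star andbT -{2}[x]starK le_cnorm_star.
Qed.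

End StarNorm.

Theorem theorem3p1 (R : realType) (q : R) (q_gtN1 : -1 < q) (q_lt1 : q < 1)
    (q_neq0 : q != 0)
    (A : cstarAlgType R) (alpha beta : A) (A_univ : is_CSUq2 q alpha beta)
    (lambda : A -> ell2 R Gamma -> ell2 R Gamma)
    (lambdaP : is_lambda q alpha beta lambda)
    (pi : A -> ell2 R Hpi_index -> ell2 R Hpi_index)
    (piP : is_pi q alpha beta pi)
    (U : ell2 R Gamma -> ell2 R (nat * Hpi_index)%type)
    (Ust : ell2 R (nat * Hpi_index)%type -> ell2 R Gamma)
    (UP : is_U U Ust) (a : A) :
  spatial_tensor toeplitz (@compact_op R Hpi_index)
    (fun x => U (lambda a (Ust x)) - optensor id (pi a) x).
Proof.
set TK := spatial_tensor _ _; pose D := difference lambda pi U Ust.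
suff : [set x | TK (D x) /\ TK (D (star x))] = setT.
  by move=> XT; have [ka _] : [set x | TK (D x) /\ TK (D (star x))] a by rewrite XT.
have bD x : bounded_op (D x) := difference_bounded lambdaP piP UP x.
have lin := difference_lincomb lambdaP piP UP.
have TKM x y : TK (D x) -> TK (D y) -> TK (D (x * y)).
  move=> kx ky; rewrite /D (differenceM lambdaP piP UP).
  have [[bpi _ _ _ _] _ _] := piP.
  have bid := @bounded_op_id R nat.
  apply: (toeplitz_compactD (toeplitz_compact_comp kx ky)).
  have kl := toeplitz_compact_compl (@id_toeplitz R) (bpi x) ky.
  exact: (toeplitz_compactD kl (toeplitz_compact_compr (@id_toeplitz R) (bpi y) kx)).
(* N and N' bound U and its inverse, and 1 accounts for pi; contractivity makes the bound linear in
   [cnorm x], so membership of D x in [TK] passes to norm limits of x. *)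
have [M M0 DM] : exists2 M, 0 <= M & forall x, norm_bound (D x) (M * cnorm x).
  have [[bU bUst _ _ _] _] := UP.
  have /bounded_opP[_ [N N0 UN]] := bU; have /bounded_opP[_ [N' N'0 UN']] := bUst.
  exists (N * N' + 1); first by rewrite addr_ge0// mulr_ge0.
  move=> x u; apply: le_trans (ler_l2normD _ _) _.
  rewrite l2normN mulrDl mulrDl mul1r.
  have [rl _ _] := lambdaP; have [rp _ _] := piP.
  apply: lerD.
    apply: le_trans (UN _) _; rewrite -!mulrA ler_wpM2l//.
    apply: le_trans (representation_contractive rl x _) _.
    by rewrite mulrCA ler_wpM2l ?cnorm_ge0.
  have [bp _ _ _ _] := rp.
  apply: (optensor_id_bound (bp x)); first exact: cnorm_ge0.
  exact: representation_contractive.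
have closed x :
  (forall e : R, 0 < e -> exists2 y, TK (D y) & cnorm (x - y) < e) -> TK (D x).
  move=> xX; apply: toeplitz_compact_closed; apply/opnorm_closureP; split=> // e e0.
  have M1 : 0 < M + 1 by rewrite ltr_wpDl.
  have [y ky xy] := xX _ (divr_gt0 e0 M1); exists (D y) => // u.
  rewrite -(differenceB lambdaP piP UP); apply: le_trans (DM _ _) _.
  rewrite ler_wpM2r ?l2norm_ge0//; move: (ltW xy); rewrite ler_pdivlMr// mulrC.
  by apply: le_trans; rewrite ler_wpM2r ?cnorm_ge0// lerDl.
have [_ gen _] := A_univ.
apply: gen => [x xX||||c x y [kx kx'] [ky ky']|x y [kx kx'] [ky ky']|x [kx kx']].
- split; apply: closed => e /xX[y [ky ky'] xy]; first by exists y.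
  by exists (star y) => //; rewrite -starB cnorm_starE.
- exact: (toeplitz_compact_difference_alpha q_gtN1 q_lt1 lambdaP piP UP).
- exact: (toeplitz_compact_difference_beta q_gtN1 q_lt1 lambdaP piP UP).
- have k1 : TK (D 1).
    rewrite /D (difference1 lambdaP piP UP).
    exact: (toeplitz_compact_sums (@tensor_sums0 R Hpi_index)).
  by split; rewrite ?star1.
- have kD d z t : TK (D z) -> TK (D t) -> TK (D (d *: z + t)).
    move=> kz kt; have -> : D (d *: z + t) = fun u => d *: D z u + D t u.
      by apply/funext => u; exact: lin.
    exact: (toeplitz_compact_lincomb d kz kt).
  by split; rewrite ?star_lincomb; exact: kD.
- by split; rewrite ?starM; exact: TKM.
- by split; rewrite ?starK.
Qed.
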